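(* Let $H$ be a separable real Hilbert space, let $1<p\le 2$, let $(\mathcal{F}_i)_{i\ge 0}$ be a filtration on a probability space, and let $(X_i)_{i\ge 1}$ be a sequence of $H$-valued random variables adapted to it. Suppose that, for some deterministic $\mu\in H$ and $v\in[0,\infty)$, almost surely, $$\mathbb{E}[X_i\mid\mathcal{F}_{i-1}]=\mu,\qquad \mathbb{E}\bigl[\lVert X_i-\mu\rVert^p\mid\mathcal{F}_{i-1}\bigr]\le v\qquad(i\ge 1).$$ Fix $k\ge 1$, $\lambda,\rho>0$, and $\delta_1,\delta_2\in(0,1)$ with $\delta_1+\delta_2<1$. Suppose that the $\mathcal{F}_k$-measurable $H$-valued pilot estimator $\widehat Z_k$ satisfies $$\mathbb{P}\bigl(\lVert\widehat Z_k-\mu\rVert\ge r(\delta_2,k)\bigr)\le\delta_2$$ for a deterministic radius $r(\delta_2,k)$. For $n>k$, define $$\widehat\mu_n=\widehat Z_k+\frac{1}{n-k}\sum_{i=k+1}^n C_{1/\lambda}(X_i-\widehat Z_k).$$ Then, on an event of probability at least $1-\delta_1-\delta_2$, simultaneously for every $n>k$, $$\lVert\widehat\mu_n-\mu\rVert\le 2^{p-1}\,\kappa_p\bigl(\rho h(\rho)\bigr)\,\lambda^{p-1}\bigl(v+r(\delta_2,k)^p\bigr)+\frac{\log(2/\delta_1)}{\rho\lambda(n-k)}.$$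
   Context: For $\tau>0$, radial clipping is the map $C_\tau:H\to H$ with $C_\tau(x)=x$ if $\lVert x\rVert\le\tau$ and $C_\tau(x)=\tau x/\lVert x\rVert$ if $\lVert x\rVert>\tau$. For $\rho>0$, $h(\rho)=\dfrac{e^{2\rho}-2\rho-1}{(2\rho)^2}$. For $1<p\le 2$ put $c_p=\dfrac{(p-1)^{p-1}}{p^p}$, and for $\lambda\ge 0$ define $$\kappa_p(\lambda)=\begin{cases}c_p(1-\lambda)^{1-p},&0\le\lambda\le 1/p,\\ \lambda,&\lambda\ge 1/p.\end{cases}$$ Conditional expectations of $H$-valued random variables are Bochner conditional expectations. *)

(* Defs.v *)
From HB Require Import structures.
From mathcomp Require Import all_boot all_order all_algebra.
From mathcomp Require Import sesquilinear.
From mathcomp Require Import all_classical all_reals all_analysis measurable_realfun.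

Set Implicit Arguments.
Unset Strict Implicit.
Unset Printing Implicit Defensive.

Import Order.TTheory GRing.Theory Num.Theory.
Import numFieldNormedType.Exports.

Local Open Scope classical_set_scope.
Local Open Scope ring_scope.

(* A real Hilbert space is a complete normed space [H] together with an inner
   product [ip : {dot H for idfun}] that induces its norm. *)
Definition induces_norm (R : realType) (H : completeNormedModType R)
  (ip : {dot H for idfun}) : Prop := forall x : H, ip x x = `|x| ^+ 2.

Definition separable (T : topologicalType) : Prop :=
  exists2 S : set T, countable S & dense S.

Definition borel (T : ptopologicalType) := g_sigma_algebraType (@open T).

(* Measurability with respect to an arbitrary sigma-algebra [G] on [Omega],
   as opposed to the ambient one; [g_sigma_algebraType G] has carrier [Omega]
   and its measurable sets are those of [G] when [G] is a sigma-algebra. *)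
Definition measurable_wrt (Omega : pointedType) (G : set (set Omega)) d
    (T : measurableType d) (f : Omega -> T) : Prop :=
  measurable_fun [set: g_sigma_algebraType G] (f : g_sigma_algebraType G -> T).

Definition filtration d (Omega : measurableType d)
    (F : nat -> set (set Omega)) : Prop :=
  [/\ forall i, sigma_algebra [set: Omega] (F i),
      forall i, F i `<=` measurable &
      forall i j, (i <= j)%N -> F i `<=` F j].

Section bochner.
Context d (Omega : measurableType d) (R : realType) (P : probability Omega R).
Context (H : completeNormedModType R).
Implicit Types (A : set Omega) (f s : Omega -> H) (G : set (set Omega)).

Definition simple_fun s : Prop :=
  finite_set (range s) /\ measurable_fun [set: Omega] (s : Omega -> borel H).

Definition simple_integral A s : H :=
  \sum_(y \in range s) fine (P (A `&` s @^-1` [set y])) *: y.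

(* [f] is Bochner integrable on [A] with integral [z]. Borel measurability
   stands for strong measurability, to which it is equivalent when [H] is
   separable. *)
Definition is_bochner_integral A f (z : H) : Prop :=
  measurable_fun A (f : Omega -> borel H) /\
  exists s : nat -> Omega -> H,
    [/\ forall m, simple_fun (s m),
        (\int[P]_(w in A) `|f w - s m w|%:E)%E @[m --> \oo] --> 0%E &
        simple_integral A (s m) @[m --> \oo] --> z].

Definition bochner_integrable f : Prop :=
  exists z, is_bochner_integral [set: Omega] f z.

(* [Y] is a version of the Bochner conditional expectation of [f] given [G]. *)
Definition is_bochner_condexp G f (Y : Omega -> H) : Prop :=
  [/\ bochner_integrable f,
      bochner_integrable Y,
      measurable_wrt G (Y : Omega -> borel H) &
      forall A, G A -> exists2 z,
        is_bochner_integral A f z & is_bochner_integral A Y z].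

End bochner.

(* [Y] is a version of the conditional expectation given [G] of the
   nonnegative function [f]; the value +oo is allowed, so that integrability
   of [f] is not presupposed. *)
Definition is_nonneg_condexp d (Omega : measurableType d) (R : realType)
    (P : probability Omega R) (G : set (set Omega)) (f Y : Omega -> \bar R) :
    Prop :=
  [/\ forall w, (0 <= Y w)%E,
      measurable_wrt G Y &
      forall A, G A -> (\int[P]_(w in A) Y w = \int[P]_(w in A) f w)%E].

Definition clip (R : realType) (H : completeNormedModType R) (tau : R)
    (x : H) : H :=
  if `|x| <= tau then x else (tau / `|x|) *: x.

Definition h (R : realType) (rho : R) : R :=
  (expR (2 * rho) - 2 * rho - 1) / (2 * rho) ^+ 2.

Definition c_coef (R : realType) (p : R) : R := (p - 1) `^ (p - 1) / p `^ p.

(* Only used for [1 < p <= 2] and [0 <= lambda]. *)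
Definition kappa (R : realType) (p lambda : R) : R :=
  if lambda <= p^-1 then c_coef p * (1 - lambda) `^ (1 - p) else lambda.

Definition mu_hat (Omega : Type) (R : realType) (H : completeNormedModType R)
    (X : nat -> Omega -> H) (Z : Omega -> H) (lambda : R) (k n : nat)
    (w : Omega) : H :=
  Z w + (n - k)%:R^-1 *:
    \sum_(k.+1 <= i < n.+1) clip lambda^-1 (X i w - Z w).

(* Main.v *)
Require Import Defs.
From mathcomp Require Import all_boot all_order all_algebra.
From mathcomp Require Import sesquilinear finmap.
From mathcomp Require Import all_classical all_reals all_analysis measurable_realfun.
From mathcomp Require Import ring lra.

Import Order.TTheory GRing.Theory Num.Theory.
Import numFieldNormedType.Exports.

Local Open Scope classical_set_scope.
Local Open Scope ring_scope.

(** Write a = rho * lambda, let B be the event that the pilot error is below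
    the radius r, and let S_n be the sum over k < i <= n of
    clip (X_i - Z) - (mu - Z), so that (n - k) (mu_hat_n - mu) = S_n.  Let K be
    the first term of the announced bound.  On B the process
    exp (- a K (n - k)) cosh (a |S_n|) is a supermartingale from time k on, and
    it starts at 1.  By the maximal inequality [ville] it stays below
    1 / delta1 at all times, outside an event of probability delta1; since
    exp u <= 2 cosh u, this gives
    a |S_n| <= a K (n - k) + ln (2 / delta1) for all n simultaneously, which is
    the claim after division by a (n - k).  The use of cosh of the norm keeps
    the bound free of the dimension and costs only the factor 2 in 2 / delta1.

    The supermartingale property fixes the constants.  An increment of S is
    the sum of a centred vector xi with |xi| <= 2 / lambda and of the bias of
    the clipping.  In a Hilbert space, up to a term linear in xi, which
    averages to zero, cosh (a |s + xi|) is at most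
    cosh (a |s|) (exp (a |xi|) - a |xi|) ([cosh_norm_le]); and
    exp u - 1 - u <= h rho * u^2 as long as u <= 2 rho
    ([expR_remainder_le]).  So the centred part multiplies the mean of
    cosh (a |S|) by at most exp (a^2 h(rho) E |clip|^2), and the bias by at
    most exp (a E (|X - Z| - 1 / lambda)_+).  Both exponents together are
    controlled by a moment of order p, and kappa p (rho * h rho) is the best
    constant for which this works ([bias_variance_le_kappa]).  Finally
    E |X - Z|^p <= 2^(p-1) (v + r^p) on B.

    Conditional expectations of the clipped vectors are never formed.  The
    supermartingale property is an inequality between integrals over the events
    A of F_(n-1).  By separability such an event splits into countably many
    events of F_(n-1) on each of which S_(n-1) and Z are constant up to eps.
    On one piece only averages over a fixed event occur: the mean vector comes
    from the Riesz representation theorem ([weak_mean]), and freezing S_(n-1)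
    and Z costs a factor exp (4 a eps) ([localized_step]).  Summing over the
    pieces and letting eps tend to 0 gives [conditional_step]. *)

(** * Inequalities for the exponential, cosh and kappa *)

(** An inequality between exponentials follows from the same inequality between
    the powers of each order; only orders from 2 on matter for the remainders
    exp x - 1 - x. *)
Lemma expR_comb_ge0 {R : realType} (s : seq (R * R)) :
  (forall n, (2 <= n)%N -> 0 <= \sum_(q <- s) q.1 * q.2 ^+ n) ->
  0 <= \sum_(q <- s) q.1 * (expR q.2 - 1 - q.2).
Proof.
move=> s_ge0.
pose u (n : nat) := \sum_(q <- s) q.1 * (series (exp_coeff q.2) n - 1 - q.2).
have u_cvg : u @ \oo --> \sum_(q <- s) q.1 * (expR q.2 - 1 - q.2).
  apply: cvg_big => [|q _]; first exact: add_continuous.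
  apply: cvgM; first exact: cvg_cst.
  apply: cvgB; last exact: cvg_cst.
  apply: cvgB; last exact: cvg_cst.
  exact: is_cvg_series_exp_coeff.
apply: (cvgr_to_ge u_cvg).
exists 2%N => // -[|[|n]] //= _.
have -> : u n.+2 = \sum_(0 <= i < n)
    (i.+2`!%:R)^-1 * \sum_(q <- s) q.1 * q.2 ^+ i.+2.
  under [RHS]eq_bigr do rewrite mulr_sumr.
  rewrite exchange_big /=; apply: eq_bigr => q _.
  rewrite /series /= !big_nat_recl //= /exp_coeff /= expr0 expr1 !divr1.
  set w := (X in 1 + (q.2 + X)).
  have -> : q.1 * (1 + (q.2 + w) - 1 - q.2) = q.1 * w by ring.
  rewrite mulr_sumr; apply: eq_bigr => i _.
  by rewrite mulrA mulrC.
by apply: sumr_ge0 => i _; rewrite mulr_ge0 ?invr_ge0 ?ler0n ?s_ge0.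
Qed.

Definition cosh {R : realType} (x : R) : R := (expR x + expR (- x)) / 2.
Definition sinh {R : realType} (x : R) : R := (expR x - expR (- x)) / 2.

Lemma convex_exprn {R : realType} (x y t : R) n : 0 <= x -> 0 <= y -> 0 <= t <= 1 ->
  (t * x + (1 - t) * y) ^+ n <= t * x ^+ n + (1 - t) * y ^+ n.
Proof.
move=> x0 y0 /andP[t0 t1]; elim: n => [|n IHn]; first by rewrite !expr0; lra.
rewrite exprS; apply: (@le_trans _ _
    ((t * x + (1 - t) * y) * (t * x ^+ n + (1 - t) * y ^+ n))).
  by apply: ler_wpM2l => //; rewrite addr_ge0 ?mulr_ge0 ?subr_ge0.
rewrite -subr_ge0 !exprS.
have -> : t * (x * x ^+ n) + (1 - t) * (y * y ^+ n) -
    (t * x + (1 - t) * y) * (t * x ^+ n + (1 - t) * y ^+ n) =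
    t * (1 - t) * ((x - y) * (x ^+ n - y ^+ n)) by ring.
apply: mulr_ge0; first by rewrite mulr_ge0 ?subr_ge0.
have [xy|yx] := leP x y.
  by apply: mulr_le0; rewrite subr_le0 ?lerXn2r ?nnegrE.
by rewrite mulr_ge0 ?subr_ge0 ?lerXn2r ?nnegrE // ltW.
Qed.

Lemma exprN_odd {R : realType} (x : R) n :
  (- x) ^+ n = if odd n then - x ^+ n else x ^+ n.
Proof. by rewrite exprNn -signr_odd; case: odd; rewrite ?expr1 ?mulN1r ?mul1r. Qed.

Lemma exprn_even_sqr {R : realType} (x : R) n : ~~ odd n -> x ^+ n = (x ^+ 2) ^+ n./2.
Proof. by move=> /even_halfK {1}<-; rewrite -mul2n exprM. Qed.

(** The function cosh (sqrt w) is convex in w, because its power series has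
    nonnegative coefficients. *)
Lemma cosh_convex_sqr {R : realType} (x y z t : R) : 0 <= t <= 1 ->
  z ^+ 2 = t * x ^+ 2 + (1 - t) * y ^+ 2 ->
  cosh z <= t * cosh x + (1 - t) * cosh y.
Proof.
move=> t01 zE.
have := expR_comb_ge0 [:: (t, x); (t, - x); (1 - t, y); (1 - t, - y);
  (-1, z); (-1, - z)].
rewrite !big_cons big_nil /= /cosh => H.
suff /H : forall n, (2 <= n)%N -> 0 <=
    \sum_(q <- [:: (t, x); (t, - x); (1 - t, y); (1 - t, - y);
                   (-1, z); (-1, - z)]) q.1 * q.2 ^+ n by lra.
move=> n _; rewrite !big_cons big_nil /=.
rewrite !exprN_odd; case: ifP => [_|/negbT n_even]; first by lra.
rewrite (exprn_even_sqr x) // (exprn_even_sqr y) // (exprn_even_sqr z) // zE.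
have := convex_exprn (x ^+ 2) (y ^+ 2) t n./2 (sqr_ge0 _) (sqr_ge0 _) t01.
lra.
Qed.

Lemma cosh_ge1 {R : realType} (x : R) : 1 <= cosh x.
Proof.
have := expR_comb_ge0 [:: (1, x); (1, -x)].
rewrite !big_cons big_nil /= => H.
suff : 0 <= 1 * (expR x - 1 - x) + (1 * (expR (- x) - 1 - - x) + 0).
  by rewrite /cosh; lra.
apply: H => n _; rewrite !big_cons big_nil /=.
rewrite !exprN_odd; case: ifP => [_|/negbT n_even]; first by lra.
by rewrite exprn_even_sqr //; have := exprn_ge0 n./2 (sqr_ge0 x); lra.
Qed.

Lemma cosh_ge0 {R : realType} (x : R) : 0 <= cosh x.
Proof. exact: le_trans ler01 (cosh_ge1 x). Qed.

Lemma cosh_le {R : realType} (x y : R) : 0 <= x -> x <= y -> cosh x <= cosh y.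
Proof.
move=> x0 xy.
have Ex : expR (- x) * expR x = 1 by rewrite -expRD addNr expR0.
have Ey : expR (- y) * expR y = 1 by rewrite -expRD addNr expR0.
have := expR_gt0 (- x); have := expR_gt0 (- y).
have : expR x <= expR y by rewrite ler_expR.
have : expR (- x) <= 1 by rewrite -expR0 ler_expR; lra.
have : expR (- y) <= 1 by rewrite -expR0 ler_expR; lra.
rewrite /cosh; move: (expR x) (expR y) (expR (- x)) (expR (- y)) Ex Ey =>
  A B A' B' AA BB B'1 A'1 AB B'0 A'0.
rewrite -subr_ge0.
have -> : (B + B') / 2 - (A + A') / 2 =
    ((B - A) * (1 - A' * B') + A' * (B' * B - 1) - B' * (A' * A - 1)) / 2 by field.
rewrite AA BB !subrr !mulr0 subr0 addr0 divr_ge0 // mulr_ge0 ?subr_ge0 //.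
by rewrite mulr_ile1 // ltW.
Qed.

(** Moving the argument of the norm by a vector of norm e / a multiplies
    cosh (a |.|) by at most exp e; all approximation errors enter this way. *)
Lemma cosh_shift {R : realType} (x y e : R) : 0 <= x -> 0 <= e -> 0 <= y -> y <= x + e ->
  cosh y <= expR e * cosh x.
Proof.
move=> x0 e0 y0 yxe; apply: (le_trans (cosh_le _ _ y0 yxe)).
rewrite /cosh mulrA ler_pM2r ?invr_gt0 // opprD mulrDr expRD expRD.
rewrite [expR e * _]mulrC lerD2l mulrC ler_pM2r ?expR_gt0 // ler_expR; lra.
Qed.

Lemma sinh_ge_id {R : realType} (x : R) : 0 <= x -> x <= sinh x.
Proof.
move=> x0; have := expR_comb_ge0 [:: (1, x); (-1, -x)].
rewrite !big_cons big_nil /= => H.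
suff : 0 <= 1 * (expR x - 1 - x) + (-1 * (expR (- x) - 1 - - x) + 0).
  by rewrite /sinh; lra.
apply: H => n _; rewrite !big_cons big_nil /=.
rewrite exprN_odd; case: ifP => _; last by lra.
by have := exprn_ge0 n x0; lra.
Qed.

Lemma h_ge0 {R : realType} (rho : R) : 0 <= h rho.
Proof.
by rewrite divr_ge0 ?sqr_ge0 // -addrA -opprD subr_ge0 addrC expR_ge1Dx.
Qed.

(** The ratio (exp u - 1 - u) / u^2 increases with u, and h rho is its value at
    2 * rho, an upper bound of a |xi| for a centred clipped vector xi. *)
Lemma expR_remainder_le {R : realType} (rho u : R) : 0 < rho -> 0 <= u <= 2 * rho ->
  expR u - 1 - u <= u ^+ 2 * h rho.
Proof.
move=> rho0 /andP[u0 u2].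
rewrite /h mulrA ler_pdivlMr ?exprn_gt0 ?mulr_gt0 //.
have := expR_comb_ge0 [:: (u ^+ 2, 2 * rho); (- (2 * rho) ^+ 2, u)].
rewrite !big_cons big_nil /= => H.
suff : 0 <= u ^+ 2 * (expR (2 * rho) - 1 - 2 * rho) +
    (- (2 * rho) ^+ 2 * (expR u - 1 - u) + 0) by lra.
apply: H => -[|[|n]] // _; rewrite !big_cons big_nil /=.
have -> : u ^+ 2 * (2 * rho) ^+ n.+2 + (- (2 * rho) ^+ 2 * u ^+ n.+2 + 0) =
  u ^+ 2 * (2 * rho) ^+ 2 * ((2 * rho) ^+ n - u ^+ n).
  by rewrite -![n.+2]addn2 !exprD; ring.
apply: mulr_ge0; first by rewrite mulr_ge0 ?sqr_ge0.
by rewrite subr_ge0 lerXn2r ?nnegrE ?mulr_ge0 // ltW.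
Qed.

Lemma bernoulli_powR {R : realType} (p x : R) : 1 < p -> 0 <= x ->
  p * x <= x `^ p + (p - 1).
Proof.
move=> p1 x0; have p0 : 0 < p by lra.
have q0 : 0 < p / (p - 1) by rewrite divr_gt0 // subr_gt0.
have pq : p^-1 + (p / (p - 1))^-1 = 1 by field; rewrite !gt_eqF //; lra.
have := @conjugate_powR R x 1 p (p / (p - 1)) x0 ler01 p0 q0 pq.
rewrite mulr1 powR1 => H.
have -> : x `^ p + (p - 1) = p * (x `^ p / p + 1 / (p / (p - 1))).
  by field; rewrite !gt_eqF //; lra.
by rewrite ler_pM2l.
Qed.

Lemma powR_add_le {R : realType} (p a b : R) : 1 <= p -> 0 <= a -> 0 <= b ->
  (a + b) `^ p <= 2 `^ (p - 1) * (a `^ p + b `^ p).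
Proof.
move=> p1 a0 b0.
have half_ge0 : 0 <= 2^-1 :> R by lra.
have half_le1 : 2^-1 <= 1 :> R by lra.
have := convex_powR p1 (Itv01 half_ge0 half_le1) (x := a) (y := b).
rewrite !inE /= !in_itv /= !andbT => /(_ a0 b0).
rewrite !convRE /= => H.
have -> : a + b = 2 * (2^-1 * a + (1 - 2^-1) * b) by field.
rewrite powRM //; last by lra.
have -> : 2 `^ p = 2 * 2 `^ (p - 1) :> R by rewrite mulr_powRB1 //; lra.
rewrite mulrAC mulrC ler_wpM2l ?powR_ge0 //.
have -> : a `^ p + b `^ p = 2 * (2^-1 * a `^ p + (1 - 2^-1) * b `^ p) by field.
by rewrite ler_pM2l.
Qed.

(** For l <= 1/p, the ratio (t - (1 - l)) / t^p is largest at
    s = p (1 - l) / (p - 1), where it equals c_p (1 - l)^(1 - p); the inequality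
    is Bernoulli's at t / s.  For l >= 1/p that maximiser is at most 1, and
    Bernoulli at t gives the constant l. *)
Lemma excess_le_kappa {R : realType} (p l t : R) : 1 < p -> 0 <= l -> 1 <= t ->
  t - 1 + l <= kappa p l * t `^ p.
Proof.
move=> p1 l0 t1; rewrite /kappa; case: ifP => [lp|/negbT]; last first.
  rewrite -ltNge => lp.
  have H := bernoulli_powR p t p1 (le_trans ler01 t1).
  have tp1 : 1 <= t `^ p by rewrite -[leLHS](powRr0 t) ler_powR //; lra.
  have : p^-1 * (t `^ p - 1) <= l * (t `^ p - 1) by rewrite ler_wpM2r ?subr_ge0 // ltW.
  suff : t - 1 <= p^-1 * (t `^ p - 1) by lra.
  by rewrite mulrC ler_pdivlMr; lra.
have p0 : 0 < p by lra.
have p10 : 0 < p - 1 by lra.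
have l1 : 0 < 1 - l by have : p^-1 < 1; [rewrite invf_lt1 //|lra].
pose s := p / (p - 1) * (1 - l).
have pp0 : 0 < p / (p - 1) by rewrite divr_gt0.
have s0 : 0 < s by rewrite mulr_gt0.
have := bernoulli_powR p (t / s) p1 (divr_ge0 (le_trans ler01 t1) (ltW s0)).
rewrite powRM ?invr_ge0 ?(ltW s0) ?(le_trans ler01 t1) //.
rewrite -powR_inv1 ?(ltW s0) // -powRrM mulN1r.
rewrite powR_inv1 ?(ltW s0) // => H.
have {}H : t <= t `^ p * (s * s `^ (- p)) / p + (1 - l).
  rewrite [leLHS](_ : t = s / p * (p * (t / s))); last by field; rewrite !gt_eqF.
  apply: (le_trans (ler_wpM2l _ H)); first by rewrite divr_ge0 // ltW.
  rewrite le_eqVlt; apply/orP; left; apply/eqP.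
  set A := t `^ p; set B := s `^ _; rewrite /s; field; rewrite !gt_eqF //; lra.
have E : c_coef p * (1 - l) `^ (1 - p) = s * s `^ (- p) / p.
  rewrite -{1}(powRr1 (ltW s0)) -powRD; last by rewrite (gt_eqF s0) implybT.
  rewrite /s powRM ?(ltW pp0) ?(ltW l1) // powRM ?invr_ge0 ?ltW //.
  rewrite -[(p - 1)^-1]powR_inv1 ?ltW //.
  rewrite -powRrM mulN1r opprB /c_coef.
  have -> : (p `^ (1 - p) = p / p `^ p).
    by rewrite powRB ?(gt_eqF p0) ?implybT // powRr1 // ltW.
  field; rewrite !gt_eqF //; exact: powR_gt0.
rewrite E; lra.
Qed.

Lemma kappa_ge_id {R : realType} (p l : R) : 1 < p -> 0 <= l -> l <= kappa p l.
Proof.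
by move=> p1 l0; have := excess_le_kappa p l 1 p1 l0 (lexx _); rewrite powR1; lra.
Qed.

(** For a vector of norm t clipped at radius 1, the first term is the
    displacement caused by the clipping and the second is l times the squared
    norm of the result: kappa balances bias against variance. *)
Lemma bias_variance_le_kappa {R : realType} (p l t : R) : 1 < p -> p <= 2 -> 0 <= l -> 0 <= t ->
  Num.max (t - 1) 0 + l * Num.min t 1 ^+ 2 <= kappa p l * t `^ p.
Proof.
move=> p1 p2 l0 t0; have [t1|t1] := leP t 1.
  rewrite max_r; last by lra.
  rewrite add0r; apply: ler_pM; rewrite ?sqr_ge0 ?kappa_ge_id //.
  have [->|tn0] := eqVneq t 0; first by rewrite expr0n /= powR_ge0.
  by rewrite -powR_mulrn // (ger_powR (a := t)) // t1 andbT lt_neqAle eq_sym tn0.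
rewrite max_l; last by lra.
by rewrite expr1n mulr1; exact: excess_le_kappa p1 l0 (ltW t1).
Qed.

Lemma clip_bias_variance_le {R : realType} (p lambda l t : R) : 1 < p -> p <= 2 ->
  0 < lambda -> 0 <= l -> 0 <= t ->
  Num.max (t - lambda^-1) 0 + l * lambda * Num.min t lambda^-1 ^+ 2 <=
  kappa p l * lambda `^ (p - 1) * t `^ p.
Proof.
move=> p1 p2 la0 l0 t0.
have := bias_variance_le_kappa p l (lambda * t) p1 p2 l0 (mulr_ge0 (ltW la0) t0).
have -> : lambda * t - 1 = lambda * (t - lambda^-1) by rewrite mulrBr divff ?gt_eqF.
have -> : Num.min (lambda * t) 1 = lambda * Num.min t lambda^-1.
  by rewrite minr_pMr ?(ltW la0) // divff ?gt_eqF.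
have -> : Num.max (lambda * (t - lambda^-1)) 0 = lambda * Num.max (t - lambda^-1) 0.
  by rewrite maxr_pMr ?mulr0 // ltW.
rewrite powRM ?(ltW la0) //.
rewrite -(mulr_powRB1 (ltW la0)) ?(lt_trans ltr01) // => H.
by rewrite -(ler_pM2l la0); lra.
Qed.

(** * Hilbert space geometry *)
Section Hilbert.
Context {R : realType} {H : completeNormedModType R} (ip : {dot H for idfun}).
Hypothesis ip_norm : induces_norm ip.
Implicit Types x y z s u : H.

Lemma ipC x y : ip x y = ip y x.
Proof. by rewrite hermitian_subproof expr0 mul1r. Qed.
Lemma ipDl x y z : ip (x + y) z = ip x z + ip y z.
Proof. exact: linearDl. Qed.
Lemma ipDr x y z : ip z (x + y) = ip z x + ip z y.
Proof. exact: linearDr. Qed.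
Lemma ipBl x y z : ip (x - y) z = ip x z - ip y z.
Proof. exact: linearBl. Qed.
Lemma ipZl a x z : ip (a *: x) z = a * ip x z.
Proof. exact: linearZl_LR. Qed.
Lemma ipZr a x z : ip z (a *: x) = a * ip z x.
Proof. exact: linearZr_LR. Qed.
Lemma ip0l z : ip 0 z = 0.
Proof. exact: linear0l. Qed.

Lemma normD_sqr x y : `|x + y| ^+ 2 = `|x| ^+ 2 + 2 * ip x y + `|y| ^+ 2.
Proof. by rewrite -!ip_norm !ipDl !ipDr (ipC y x); ring. Qed.

Lemma normB_sqr x y : `|x - y| ^+ 2 = `|x| ^+ 2 - 2 * ip x y + `|y| ^+ 2.
Proof. by rewrite normD_sqr normrN -scaleN1r ipZr; ring. Qed.

Lemma ip_le_norm x y : `|ip x y| <= `|x| * `|y|.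
Proof.
suff half u v : ip u v <= `|u| * `|v|.
  by rewrite ler_norml half andbT lerNl -mulN1r -ipZl (le_trans (half _ _)) // scaleN1r normrN.
have [/normr0_eq0->|u0] := eqVneq `|u| 0; first by rewrite ip0l normr0 mul0r.
have [/normr0_eq0->|v0] := eqVneq `|v| 0; first by rewrite ipC ip0l normr0 mulr0.
have := sqr_ge0 `| `|v| *: u - `|u| *: v|.
rewrite normB_sqr ipZl ipZr !normrZ !normr_id.
have -> : (`|v| * `|u|) ^+ 2 - 2 * (`|v| * (`|u| * ip u v)) + (`|u| * `|v|) ^+ 2 =
  2 * (`|u| * `|v|) * (`|u| * `|v| - ip u v) by ring.
by rewrite pmulr_rge0 ?subr_ge0 // !mulr_gt0 // lt_neqAle eq_sym normr_ge0 ?u0 ?v0.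
Qed.

Lemma ip_continuous u : continuous (fun x => ip x u).
Proof.
move=> x; apply/cvgrPdist_lt => e e0.
have d0 : 0 < e / (`|u| + 1) by rewrite divr_gt0 // ltr_wpDl.
have : \forall t \near nbhs x, `|x - t| < e / (`|u| + 1).
  by apply/nbhs_ballP; exists (e / (`|u| + 1)) => // y; rewrite -ball_normE.
apply: filterS => t xt; rewrite -ipBl (le_lt_trans (ip_le_norm _ _)) //.
apply: (@le_lt_trans _ _ (`|x - t| * (`|u| + 1))); first by rewrite ler_wpM2l // lerDl.
by rewrite -ltr_pdivlMr // ltr_wpDl.
Qed.

(** The representing vector minimises J x = |x|^2 - 2 L x: by the parallelogram
    identity a minimising sequence is Cauchy, and the first-order condition at
    the limit reads L = ip m. *)
Lemma riesz (L : H -> R) (M : R) :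
  (forall x y, L (x + y) = L x + L y) ->
  (forall a x, L (a *: x) = a * L x) ->
  (forall x, `|L x| <= M * `|x|) ->
  exists m, forall u, L u = ip m u.
Proof.
move=> LD LZ LM.
pose J (x : H) : R := `|x| ^+ 2 - 2 * L x.
have J_lb x : - M ^+ 2 <= J x.
  have /ler_normlW Lx := LM x.
  have := sqr_ge0 (`|x| - M); rewrite /J; move: (L x) (`|x|) Lx => a b.
  nra.
pose i := inf (range J).
have J_inf : has_inf (range J).
  split; first by exists (J 0), 0.
  by exists (- M ^+ 2) => _ [x _ <-].
have i_le x : i <= J x by apply: ge_inf; [exact: J_inf.2|exists x].
have /choice[x xE] n : exists x, J x < i + n.+1%:R^-1.
  have [|_ [x _ <-] Jx] := @inf_adherent _ (range J) n.+1%:R^-1 _ J_inf.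
    by rewrite invr_gt0.
  by exists x.
have x_near n m : `|x n - x m| ^+ 2 <= 2 * n.+1%:R^-1 + 2 * m.+1%:R^-1.
  have : `|x n - x m| ^+ 2 = 2 * J (x n) + 2 * J (x m) - 4 * J (2^-1 *: (x n + x m)).
    rewrite /J normB_sqr normrZ exprMn normD_sqr LZ LD.
    by rewrite gtr0_norm //; field.
  have := xE n; have := xE m; have := i_le (2^-1 *: (x n + x m)).
  move: (J (x n)) (J (x m)) (J _) (n.+1%:R^-1) (m.+1%:R^-1) => A B C D E.
  lra.
have x_cvg : cvgn x.
  apply: cauchy_cvg; apply/cauchy_exP => e e0.
  have [N _ N_small] :=
    near_infty_natSinv_lt (PosNum (divr_gt0 (exprn_gt0 2 e0) (ltr0n _ 4))).
  exists (x N); exists N => // n /= Nn.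
  rewrite -ball_normE /= -(ltr_pXn2r (n := 2)) ?nnegrE ?(ltW e0) //.
  apply: (le_lt_trans (x_near N n)).
  have := N_small N (leqnn _); have := N_small n Nn; rewrite /=.
  by move: (n.+1%:R^-1) (N.+1%:R^-1) => A B; lra.
exists (lim (x @ \oo)) => u.
have ip_cvg : (fun n => ip (x n) u : R) @ \oo --> ip (lim (x @ \oo)) u.
  exact: (cvg_comp _ _ x_cvg (ip_continuous u _)).
have quad t : 0 <= 2 * t * (ip (lim (x @ \oo)) u - L u) + t ^+ 2 * `|u| ^+ 2.
  have : (fun n => 2 * t * (ip (x n) u - L u) + t ^+ 2 * `|u| ^+ 2 + n.+1%:R^-1) @ \oo -->
     2 * t * (ip (lim (x @ \oo)) u - L u) + t ^+ 2 * `|u| ^+ 2 + 0.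
    apply: cvgD; last exact: cvg_harmonic.
    apply: cvgD; last exact: cvg_cst.
    by apply: cvgM; [exact: cvg_cst|apply: cvgB => //; exact: cvg_cst].
  rewrite addr0 => /cvgr_to_ge; apply; near=> n.
  have := i_le (x n + t *: u); have := xE n.
  rewrite /J LD LZ normD_sqr ipZr normrZ exprMn real_normK ?num_real //.
  move: (n.+1%:R^-1) => A; lra.
set c := ip _ u - L u in quad.
suff : c = 0 by rewrite /c; lra.
(* A step opposite to c, short enough for the linear term to win. *)
apply/eqP; apply: contraT => c0.
have D0 : 0 < `|u| ^+ 2 + 1 by rewrite ltr_wpDl ?sqr_ge0.
have := quad (- c / (`|u| ^+ 2 + 1)).
have -> : 2 * (- c / (`|u| ^+ 2 + 1)) * c + (- c / (`|u| ^+ 2 + 1)) ^+ 2 * `|u| ^+ 2 =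
   - (c / (`|u| ^+ 2 + 1)) ^+ 2 * (`|u| ^+ 2 + 2).
  by field; rewrite gt_eqF.
rewrite leNgt mulNr oppr_lt0 mulr_gt0 //.
by rewrite exprn_even_gt0 //= mulf_neq0 // invr_neq0 // gt_eqF.
Unshelve. all: by end_near.
Qed.

(** With c the cosine of the angle between s and x, the square of a |s + x| is
    the convex combination of (a |s| + a |x|)^2 and (a |s| - a |x|)^2 with
    weights (1 + c) / 2 and (1 - c) / 2, so [cosh_convex_sqr] applies.  When
    s = 0 or x = 0, the convention 1 / 0 = 0 gives c = 0, which is still
    correct. *)
Lemma cosh_norm_le (a : R) s x : 0 <= a ->
  cosh (a * `|s + x|) <=
    cosh (a * `|s|) * (expR (a * `|x|) - a * `|x|) +
    a * sinh (a * `|s|) / `|s| * ip s x.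
Proof.
move=> a0; set X := a * `|s|; set y := a * `|x|.
have X0 : 0 <= X by rewrite mulr_ge0.
have y0 : 0 <= y by rewrite mulr_ge0.
pose c := ip s x / (`|s| * `|x|).
have ipE : ip s x = c * `|s| * `|x|.
  have [s0|s0] := eqVneq `|s| 0; first by rewrite s0 (normr0_eq0 s0) ip0l mulr0 mul0r.
  have [x0|x0] := eqVneq `|x| 0; first by rewrite x0 (normr0_eq0 x0) ipC ip0l mulr0.
  by rewrite /c -mulrA divfK // mulf_neq0.
have c1 : `|c| <= 1.
  have := ip_le_norm s x; rewrite /c normrM normfV normrM !normr_id => sx.
  have [->|sx0] := eqVneq (`|s| * `|x|) 0; first by rewrite invr0 mulr0.
  by rewrite ler_pdivrMr ?mul1r // lt_neqAle eq_sym sx0 mulr_ge0.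
have {}c1 : - 1 <= c <= 1 by rewrite -ler_norml.
apply: (@le_trans _ _ ((1 + c) / 2 * cosh (X + y) + (1 - (1 + c) / 2) * cosh (X - y))).
  apply: cosh_convex_sqr; first by lra.
  by rewrite exprMn normD_sqr ipE /X /y; field.
have -> : a * sinh X / `|s| * ip s x = c * sinh X * y.
  rewrite ipE /y; have [s0|s0] := eqVneq `|s| 0; last by field.
  by rewrite /X s0 mulr0 /sinh oppr0 subrr mul0r mulr0 !mul0r mulr0 mul0r.
have sX := sinh_ge_id _ X0; have sy := sinh_ge_id _ y0.
have sXc : sinh X <= cosh X by have := expR_gt0 (- X); rewrite /sinh /cosh; lra.
have -> : expR y = cosh y + sinh y by rewrite /sinh /cosh; field.
have -> : cosh (X + y) = cosh X * cosh y + sinh X * sinh y.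
  by rewrite /cosh /sinh opprD !expRD; field.
have -> : cosh (X - y) = cosh X * cosh y - sinh X * sinh y.
  by rewrite /cosh /sinh opprD opprK !expRD; field.
(* This replaces c sinh X sinh y by c sinh X y, which is linear in x. *)
have : c * sinh X * (sinh y - y) <= cosh X * (sinh y - y).
  by rewrite ler_wpM2r ?subr_ge0 //; nra.
lra.
Qed.

End Hilbert.

Section Clip.
Context {R : realType} {H : completeNormedModType R}.
Lemma norm_clip (tau : R) (x : H) : 0 < tau -> `|clip tau x| = Num.min `|x| tau.
Proof.
move=> t0; rewrite /clip; case: leP => // xt.
by rewrite normrZ ger0_norm ?divr_ge0 ?(ltW t0) // divfK // gt_eqF // (lt_trans t0).
Qed.

Lemma norm_sub_clip (tau : R) (x : H) : 0 < tau ->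
  `|clip tau x - x| = Num.max (`|x| - tau) 0.
Proof.
move=> t0; rewrite /clip; case: (leP `|x| tau) => xt.
  by rewrite subrr normr0 max_r // subr_le0.
have x0 : 0 < `|x| by apply: lt_trans xt.
rewrite max_l; last by rewrite subr_ge0 ltW.
rewrite -[X in _ - X]scale1r -scalerBl normrZ ler0_norm.
  by rewrite opprB mulrBl mul1r divfK ?gt_eqF.
by rewrite subr_le0 ler_pdivrMr // mul1r ltW.
Qed.

Lemma clip_continuous (tau : R) : 0 < tau -> continuous (clip tau : H -> H).
Proof.
move=> t0; have -> : clip tau = fun x : H => (tau / Num.max tau `|x|) *: x.
  apply/funext => x; rewrite /clip; case: leP => // _.
  by rewrite divff ?gt_eqF // scale1r.
move=> x; apply: cvgZ; last exact: cvg_id.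
apply: cvgM; first exact: cvg_cst.
apply: cvgV; first by rewrite gt_eqF // lt_max t0.
apply: (@continuous_max R H (fun=> tau) (fun y : H => `|y|)); first exact: cvg_cst.
exact: norm_continuous.
Qed.
End Clip.

(** * Measurability of maps into a separable space *)
Section Separable.
Context {R : realType} {H : completeNormedModType R}.

Lemma separable_dense_seq : separable H ->
  exists e : nat -> H, forall x (eps : R), 0 < eps -> exists j, `|x - e j| < eps.
Proof.
move=> [S S_count S_dense].
have [S0|[e]] := pfcard_geP S_count.
  have [] := S_dense setT; [by exists 0|exact: openT|].
  by rewrite S0 => x [].
exists e => x eps eps0.
have [|y [xy Sy]] := S_dense (ball x eps) _ (ball_open x eps).
  by exists x; exact: ballxx.
have [j _ jy] := @surj _ _ _ _ e y Sy.
by exists j; move: xy; rewrite -ball_normE jy.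
Qed.

Section Measurability.
Context {d} {T : measurableType d}.
Hypothesis H_sep : separable H.

Lemma borel_open_preimage (f : T -> H) (U : set H) :
  measurable_fun [set: T] (f : T -> borel H) -> open U -> measurable (f @^-1` U).
Proof.
move=> mf oU; rewrite -[_ @^-1` _]setTI; apply: mf => //.
exact: sub_sigma_algebra.
Qed.

(** The Borel sigma-algebra of a separable space is compatible with products:
    an open condition on the pair (f w, g w) is a countable union of conditions
    that f w and g w lie in balls around points of a dense sequence. *)
Lemma continuous2_open_preimage {K : topologicalType} (F : H * H -> K)
    (f g : T -> H) (U : set K) : continuous F ->
  measurable_fun [set: T] (f : T -> borel H) ->
  measurable_fun [set: T] (g : T -> borel H) ->
  open U -> measurable [set w | U (F (f w, g w))].
Proof.
move=> cF mf mg oU.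
have [e e_dense] := separable_dense_seq H_sep.
pose r n : R := n.+1%:R^-1.
have r0 n : 0 < r n by rewrite invr_gt0.
pose I : set (nat * nat * nat) := [set q | forall y z,
  ball (e q.1.1) (r q.2) y -> ball (e q.1.2) (r q.2) z -> U (F (y, z))].
have -> : [set w | U (F (f w, g w))] = \bigcup_q
    (if q \in I then f @^-1` ball (e q.1.1) (r q.2) `&` g @^-1` ball (e q.1.2) (r q.2)
     else set0).
  apply/seteqP; split => w /=; last first.
    by move=> [q _]; case: ifPn => // /set_mem qI [] /qI; apply.
  move=> Uw.
  have : nbhs (f w, g w) (F @^-1` U) by apply: cF; apply: open_nbhs_nbhs.
  move=> /nbhs_ballP [eps /= eps0 epsU].
  have [n _ /(_ n (leqnn _)) /= n_eps] :=
    near_infty_natSinv_lt (PosNum (divr_gt0 eps0 (ltr0n _ 2))).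
  have [i fi] := e_dense (f w) _ (r0 n).
  have [j gj] := e_dense (g w) _ (r0 n).
  exists (i, j, n) => //=.
  rewrite mem_set /=.
    by rewrite -!ball_normE /= distrC; split => //=; rewrite distrC.
  move=> y z; rewrite -!ball_normE /= => iy jz; apply: epsU; split => /=; rewrite -ball_normE /=.
    apply: (le_lt_trans (ler_distD (e i) _ _)).
    by move: fi iy n_eps; rewrite /r; move: (n.+1%:R^-1) => A; lra.
  apply: (le_lt_trans (ler_distD (e j) _ _)).
  by move: gj jz n_eps; rewrite /r; move: (n.+1%:R^-1) => A; lra.
apply: countable_bigcupT_measurable => // q; case: ifPn => // _.
by apply: measurableI; apply: borel_open_preimage => //; exact: ball_open.
Qed.

Lemma measurable_continuous2 (F : H * H -> H) (f g : T -> H) : continuous F ->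
  measurable_fun [set: T] (f : T -> borel H) ->
  measurable_fun [set: T] (g : T -> borel H) ->
  measurable_fun [set: T] ((fun w => F (f w, g w)) : T -> borel H).
Proof.
move=> cF mf mg; apply: (@measurability _ _ T (borel H) _ _ (@open H) erefl) => _ [U oU <-].
by rewrite setTI; exact: (continuous2_open_preimage F f g U).
Qed.

Lemma measurable_continuous (F : H -> H) (f : T -> H) : continuous F ->
  measurable_fun [set: T] (f : T -> borel H) ->
  measurable_fun [set: T] ((fun w => F (f w)) : T -> borel H).
Proof.
move=> cF mf; apply: (@measurability _ _ T (borel H) _ _ (@open H) erefl) => _ [U oU <-].
rewrite setTI; apply: (borel_open_preimage f (F @^-1` U)) => //.
by move/continuousP : cF; apply.
Qed.

Lemma measurable_continuous_real (F : H -> R) (f : T -> H) : continuous F ->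
  measurable_fun [set: T] (f : T -> borel H) ->
  measurable_fun [set: T] (fun w => F (f w)).
Proof.
move=> cF mf; apply: (measurability _ (RGenOpens.measurableE R)) => _ [_ [a [b ->]] <-].
rewrite setTI; apply: (borel_open_preimage f (F @^-1` `]a, b[)) => //.
by move/continuousP : cF; apply; exact: interval_open.
Qed.

Lemma measurable_norm (f : T -> H) :
  measurable_fun [set: T] (f : T -> borel H) ->
  measurable_fun [set: T] (fun w => `|f w|).
Proof. by apply: measurable_continuous_real; exact: norm_continuous. Qed.

Lemma measurable_addH (f g : T -> H) :
  measurable_fun [set: T] (f : T -> borel H) ->
  measurable_fun [set: T] (g : T -> borel H) ->
  measurable_fun [set: T] ((fun w => f w + g w) : T -> borel H).
Proof. by apply: (measurable_continuous2 (fun z => z.1 + z.2)); exact: add_continuous. Qed.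

Lemma measurable_subH (f g : T -> H) :
  measurable_fun [set: T] (f : T -> borel H) ->
  measurable_fun [set: T] (g : T -> borel H) ->
  measurable_fun [set: T] ((fun w => f w - g w) : T -> borel H).
Proof. by apply: (measurable_continuous2 (fun z => z.1 - z.2)); exact: sub_continuous. Qed.

Lemma measurable_ip (ip : {dot H for idfun}) (ip_norm : induces_norm ip) (u : H) (f : T -> H) :
  measurable_fun [set: T] (f : T -> borel H) ->
  measurable_fun [set: T] (fun w => ip (f w) u).
Proof. by apply: (measurable_continuous_real (ip^~ u)); exact: ip_continuous. Qed.

End Measurability.
End Separable.

Lemma measurable_cosh {R : realType} d (T : measurableType d) (g : T -> R) :
  measurable_fun [set: T] g -> measurable_fun [set: T] (fun w => cosh (g w)).
Proof.
move=> mg.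
have m1 : measurable_fun [set: T] (fun w => expR (g w)).
  by have := @measurableT_comp _ _ _ T _ _ expR setT g (@measurable_expR R) mg.
have m2 : measurable_fun [set: T] (fun w => expR (- g w)).
  by have := @measurableT_comp _ _ _ T _ _ expR setT (\- g)
    (@measurable_expR R) (measurable_funN mg).
rewrite /cosh; apply: measurable_funM; last exact: measurable_cst.
exact: measurable_funD.
Qed.

(** * Integrals over an event *)
Section Integrals.
Context {d} {Omega : measurableType d} {R : realType} (P : probability Omega R).
Implicit Types (A : set Omega) (g : Omega -> R).

Lemma bounded_integrable {A g} (M : R) : measurable A ->
  measurable_fun [set: Omega] g -> (forall w, A w -> `|g w| <= M) ->
  P.-integrable A (EFin \o g).
Proof.
move=> mA mg gM; apply: measurable_bounded_integrable => //.
- by rewrite (le_lt_trans (probability_le1 P mA)) // ltry.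
- exact: measurable_funTS.
- exists M; split; first exact: num_real.
  by move=> x /ltW Mx w Aw; exact: le_trans (gM w Aw) Mx.
Qed.

Lemma dominated_integrable {A g} (g' : Omega -> R) : measurable A ->
  measurable_fun [set: Omega] g -> P.-integrable A (EFin \o g') ->
  (forall w, A w -> `|g w| <= g' w) ->
  P.-integrable A (EFin \o g).
Proof.
move=> mA mg ig' gg'; apply: le_integrable ig' => //.
  by apply/measurable_EFinP; exact: measurable_funTS.
by move=> w Aw /=; rewrite lee_fin (le_trans (gg' w Aw)) // ler_norm.
Qed.

Lemma integrable_cstR {A} (c : R) : measurable A -> P.-integrable A (EFin \o cst c).
Proof.
by move=> mA; apply: (bounded_integrable `|c|) => //.
Qed.

Lemma integrableDR {A g} {g' : Omega -> R} : measurable A -> P.-integrable A (EFin \o g) ->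
  P.-integrable A (EFin \o g') -> P.-integrable A (EFin \o (fun w => g w + g' w)).
Proof. by move=> mA ig ig'; have := integrableD mA ig ig'. Qed.

Lemma integrableBR {A g} {g' : Omega -> R} : measurable A -> P.-integrable A (EFin \o g) ->
  P.-integrable A (EFin \o g') -> P.-integrable A (EFin \o (fun w => g w - g' w)).
Proof. by move=> mA ig ig'; have := integrableB mA ig ig'. Qed.

Lemma integrableZR {A g} (c : R) : measurable A -> P.-integrable A (EFin \o g) ->
  P.-integrable A (EFin \o (fun w => c * g w)).
Proof. by move=> mA ig; have := integrableZl mA c ig. Qed.

Lemma integrable_sumR {A} {I : Type} (s : seq I) (G : I -> Omega -> R) : measurable A ->
  (forall i, P.-integrable A (EFin \o G i)) ->
  P.-integrable A (EFin \o (fun w => \sum_(i <- s) G i w)).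
Proof.
move=> mA iG; elim: s => [|i s IHs].
  by under [X in EFin \o X]funext => w do rewrite big_nil; exact: integrable_cstR.
by under [X in EFin \o X]funext => w do rewrite big_cons; exact: integrableDR.
Qed.

Lemma Rintegral_sum {A} {I : Type} (s : seq I) (G : I -> Omega -> R) : measurable A ->
  (forall i, P.-integrable A (EFin \o G i)) ->
  \int[P]_(w in A) (\sum_(i <- s) G i w) = \sum_(i <- s) \int[P]_(w in A) G i w.
Proof.
move=> mA iG; elim: s => [|i s IHs].
  rewrite big_nil; under eq_Rintegral do rewrite big_nil.
  by rewrite Rintegral_cst // mul0r.
rewrite big_cons -IHs; under eq_Rintegral do rewrite big_cons.
by rewrite RintegralD //; exact: integrable_sumR.
Qed.

Lemma Rintegral_indic {A B} : measurable A -> measurable B ->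
  \int[P]_(w in A) (\1_B w : R) = fine (P (A `&` B)).
Proof. by move=> mA mB; rewrite /Rintegral integral_indic // setIC. Qed.

End Integrals.

Section Bochner.
Context {d} {Omega : measurableType d} {R : realType} (P : probability Omega R).
Context {H : completeNormedModType R} (ip : {dot H for idfun}).
Hypothesis ip_norm : induces_norm ip.
Implicit Types (A : set Omega) (f s : Omega -> H).

Lemma borel_set1 (y : H) : measurable ([set y] : set (borel H)).
Proof.
rewrite -[[set y]]setCK; apply: measurableC; apply: sub_sigma_algebra.
exact/closed_openC/accessible_closed_set1/hausdorff_accessible/norm_hausdorff.
Qed.

Lemma simple_fun_bounded s : simple_fun s -> exists M, forall w, `|s w| <= M.
Proof.
move=> [fs _]; exists (\sum_(y <- fset_set (range s)) `|y|) => w.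
have sw : s w \in fset_set (range s) by rewrite in_fset_set // mem_set //; exists w.
by rewrite (big_rem (s w)) //= lerDl sumr_ge0.
Qed.

Lemma simple_integral_ip A s u : measurable A -> simple_fun s ->
  \int[P]_(w in A) ip (s w) u = ip (simple_integral P A s) u.
Proof.
move=> mA [fs ms]; rewrite /simple_integral fsbig_finite //=.
have mpre y : measurable (s @^-1` [set y]).
  by rewrite -[_ @^-1` _]setTI; apply: ms => //; exact: borel_set1.
have iind y : P.-integrable A (EFin \o (fun w => ip y u * \1_(s @^-1` [set y]) w)).
  apply: integrableZR => //; apply: (bounded_integrable P 1) => // w _.
  by rewrite indicE; case: (_ \in _); rewrite ?normr0 ?normr1.
transitivity (\int[P]_(w in A) \sum_(y <- fset_set (range s)) ip y u * \1_(s @^-1` [set y]) w).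
  apply: eq_Rintegral => w _ /=.
  have sw : s w \in fset_set (range s) by rewrite in_fset_set // mem_set //; exists w.
  rewrite (big_rem (s w)) //= indicE mem_set // mulr1 big_seq big1 ?addr0 // => y.
  rewrite mem_rem_uniq ?fset_uniq // inE => /andP[ysw _].
  by rewrite indicE memNset ?mulr0 //= => /esym/eqP; rewrite (negbTE ysw).
rewrite Rintegral_sum // (big_morph (ip^~ u) (fun x y => ipDl ip x y u) (ip0l ip u)).
apply: eq_bigr => y _.
rewrite RintegralZl ?Rintegral_indic // ?ipZl 1?mulrC //.
apply: (bounded_integrable P 1) => // w _.
by rewrite indicE; case: (_ \in _); rewrite ?normr0 ?normr1.
Qed.

Hypothesis H_sep : separable H.

Lemma approx_integrable A f s : measurable A ->
  measurable_fun [set: Omega] (f : Omega -> borel H) -> simple_fun s ->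
  (\int[P]_(w in A) `|f w - s w|%:E)%E \is a fin_num ->
  P.-integrable A (EFin \o (fun w => `|f w - s w|)).
Proof.
move=> mA mf [_ ms] fin; apply/integrableP; split.
  apply/measurable_EFinP; apply: measurable_funTS; apply: measurable_norm.
  exact: measurable_subH.
rewrite (eq_integral (fun w => `|f w - s w|%:E)); last first.
  by move=> w _ /=; rewrite normr_id.
by rewrite ltey_eq fin.
Qed.

Lemma bochner_integrable_norm A f z : measurable A ->
  measurable_fun [set: Omega] (f : Omega -> borel H) ->
  is_bochner_integral P A f z -> P.-integrable A (EFin \o (fun w => `|f w|)).
Proof.
move=> mA mf [_ [s [ss /fine_cvgP[[n _ fin] _] _]]].
have [M sM] := simple_fun_bounded _ (ss n).
have ifs := approx_integrable _ _ _ mA mf (ss n) (fin n (leqnn n)).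
apply: (dominated_integrable _ (fun w => `|f w - s n w| + M)) => //.
- exact: measurable_norm.
- by apply: integrableDR => //; exact: integrable_cstR.
- move=> w _; rewrite normr_id -[X in `|X| <= _](subrK (s n w)).
  by rewrite (le_trans (ler_normD _ _)) // lerD2l.
Qed.

Lemma integrable_ip A f u : measurable A ->
  measurable_fun [set: Omega] (f : Omega -> borel H) ->
  P.-integrable A (EFin \o (fun w => `|f w|)) ->
  P.-integrable A (EFin \o (fun w => ip (f w) u)).
Proof.
move=> mA mf nf; apply: (dominated_integrable _ (fun w => `|u| * `|f w|)) => //.
- exact: measurable_ip.
- exact: integrableZR.
- by move=> w _; rewrite mulrC ip_le_norm.
Qed.

(** Inner products commute with Bochner integrals.  This turns the hypothesis
    on conditional means into statements on real integrals. *)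
Lemma bochner_integral_ip A f z u : measurable A ->
  measurable_fun [set: Omega] (f : Omega -> borel H) ->
  is_bochner_integral P A f z -> \int[P]_(w in A) ip (f w) u = ip z u.
Proof.
move=> mA mf fz; have [_ [s [ss /fine_cvgP[s_fin s_cvg] s_lim]]] := fz.
have if_ := integrable_ip _ _ u mA mf (bochner_integrable_norm _ _ _ mA mf fz).
have ip_lim : (fun m => ip (simple_integral P A (s m)) u : R) @ \oo --> ip z u.
  exact: (cvg_comp _ _ s_lim (ip_continuous ip ip_norm u z)).
apply: (cvg_unique _ _ ip_lim); first exact: Rhausdorff.
have {}s_cvg : (fun m => `|u| * \int[P]_(w in A) `|f w - s m w|) @ \oo --> `|u| * 0.
  by apply: cvgM => //; exact: cvg_cst.
rewrite mulr0 in s_cvg.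
apply/cvgrPdist_lt => e e0.
move/cvgrPdist_lt : s_cvg => /(_ e e0).
apply: filterS2 s_fin => m m_fin; rewrite sub0r normrN; apply: le_lt_trans.
rewrite (le_trans _ (ler_norm _)) //.
have ms := (ss m).2.
have [M sM] := simple_fun_bounded _ (ss m).
have ifs := approx_integrable _ _ _ mA mf (ss m) m_fin.
have iips : P.-integrable A (EFin \o (fun w => ip (s m w) u)).
  apply: integrable_ip => //; apply: (bounded_integrable P M) => //.
    exact: measurable_norm.
  by move=> w _; rewrite normr_id.
rewrite -simple_integral_ip // -RintegralB // -RintegralZl //.
have idiff := integrableBR P mA if_ iips.
apply: le_trans; first exact: le_normr_Rintegral.
apply: le_Rintegral => //.
- by have := integrable_norm idiff.
- exact: integrableZR.
- by move=> w _; rewrite -ipBl mulrC ip_le_norm.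
Qed.
End Bochner.

(** * Averages of a bounded vector over an event *)
Section Mean.
Context {d} {Omega : measurableType d} {R : realType} (P : probability Omega R).
Context {H : completeNormedModType R} (ip : {dot H for idfun}).
Hypothesis ip_norm : induces_norm ip.
Hypothesis H_sep : separable H.

Section OnSet.
Context (A : set Omega) (f : Omega -> H) (M : R).
Hypothesis mA : measurable A.
Hypothesis mf : measurable_fun [set: Omega] (f : Omega -> borel H).
Hypothesis fM : forall w, A w -> `|f w| <= M.
Hypothesis PA0 : 0 < fine (P A).

Lemma bounded_integrable_ip u : P.-integrable A (EFin \o (fun w => ip (f w) u)).
Proof.
apply: integrable_ip => //; apply: (bounded_integrable P M) => //.
  exact: measurable_norm.
by move=> w Aw; rewrite normr_id fM.
Qed.

(** Boundedness of f makes u |-> E [<f, u> | A] a bounded linear form, so that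
    Riesz yields the mean vector of f over A. *)
Lemma weak_mean : exists m : H,
  forall u, \int[P]_(w in A) ip (f w) u = fine (P A) * ip m u.
Proof.
pose L u := (fine (P A))^-1 * \int[P]_(w in A) ip (f w) u.
have [||u|m mL] := @riesz R H ip ip_norm L M.
- move=> x y; rewrite /L -mulrDr -RintegralD //; try exact: bounded_integrable_ip.
  by congr (_ * _); apply: eq_Rintegral => w _; rewrite ipDr.
- move=> c x; rewrite /L mulrCA; congr (_ * _).
  rewrite -RintegralZl //; last exact: bounded_integrable_ip.
  by apply: eq_Rintegral => w _; rewrite ipZr.
- rewrite /L normrM normfV (gtr0_norm PA0) ler_pdivrMl //.
  have iu := bounded_integrable_ip u.
  apply: le_trans; first exact: le_normr_Rintegral.
  rewrite mulrC -Rintegral_cst //; apply: le_Rintegral => //.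
  + by have := integrable_norm iu.
  + exact: integrable_cstR.
  + move=> w Aw; apply: (le_trans (ip_le_norm _ ip_norm _ _)).
    by rewrite ler_wpM2r // fM.
exists m => u; rewrite -mL /L mulrA mulfV ?mul1r //; exact: lt0r_neq0.
Qed.

Section WithMean.
Context (m : H).
Hypothesis mE : forall u, \int[P]_(w in A) ip (f w) u = fine (P A) * ip m u.

Lemma weak_mean_norm : `|m| <= M.
Proof.
have [m0|m0] := eqVneq `|m| 0.
  have [w Aw] : A !=set0.
    by apply/set0P; apply: contraTneq PA0 => ->; rewrite measure0 ltxx.
  by rewrite m0; exact: le_trans (normr_ge0 _) (fM w Aw).
have {}m0 : 0 < `|m| by rewrite lt_neqAle eq_sym m0 normr_ge0.
have : fine (P A) * ip m m <= M * `|m| * fine (P A).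
  rewrite -mE -Rintegral_cst //; apply: le_Rintegral => //.
  - exact: bounded_integrable_ip.
  - exact: integrable_cstR.
  - move=> w Aw; apply: (le_trans (ler_norm _)); apply: (le_trans (ip_le_norm _ ip_norm _ _)).
    by rewrite ler_wpM2r // fM.
by rewrite ip_norm mulrC ler_pM2r // expr2 ler_pM2r.
Qed.

Lemma bounded_integrable_normX n : P.-integrable A (EFin \o (fun w => `|f w| ^+ n)).
Proof.
apply: (bounded_integrable P (M ^+ n)) => //.
  by apply: measurable_funX; exact: measurable_norm.
move=> w Aw; rewrite ger0_norm ?exprn_ge0 // lerXn2r ?nnegrE ?fM //.
exact: le_trans (normr_ge0 _) (fM w Aw).
Qed.

Lemma weak_mean_variance :
  \int[P]_(w in A) (`|f w - m| ^+ 2) <= \int[P]_(w in A) (`|f w| ^+ 2).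
Proof.
have -> : \int[P]_(w in A) (`|f w - m| ^+ 2) =
    \int[P]_(w in A) ((`|f w| ^+ 2 - 2 * ip (f w) m) + `|m| ^+ 2).
  by apply: eq_Rintegral => w _; rewrite (normB_sqr _ ip_norm).
have im := bounded_integrable_ip m.
have i2 := bounded_integrable_normX 2.
have i2m : P.-integrable A (EFin \o (fun w => 2 * ip (f w) m)) by exact: integrableZR.
have ic : P.-integrable A (EFin \o (fun=> `|m| ^+ 2)) by exact: integrable_cstR.
rewrite RintegralD //; last exact: integrableBR.
rewrite RintegralB // RintegralZl // Rintegral_cst // mE ip_norm.
have : 0 <= fine (P A) * `|m| ^+ 2 by rewrite mulr_ge0 ?sqr_ge0 // ltW.
lra.
Qed.

(** One step of the supermartingale, for a centred increment and a starting point
    s that is constant on A: the linear term of [cosh_norm_le] vanishes on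
    average, and a |f - m| <= 2 a M <= 2 rho brings in h rho. *)
Lemma cosh_mean_le (a rho : R) (s : H) : 0 <= a -> 0 < rho -> a * M <= rho ->
  \int[P]_(w in A) cosh (a * `|s + (f w - m)|) <=
  cosh (a * `|s|) * (fine (P A) + a ^+ 2 * h rho * \int[P]_(w in A) (`|f w| ^+ 2)).
Proof.
move=> a0 rho0 aM.
have mfm : measurable_fun [set: Omega] ((fun w => f w - m) : Omega -> borel H).
  by apply: measurable_subH => //; exact: measurable_cst.
have fmM w : A w -> `|f w - m| <= 2 * M.
  by move=> Aw; rewrite mulr_natl mulr2n (le_trans (ler_normB _ _)) // lerD ?fM ?weak_mean_norm.
have i2 : P.-integrable A (EFin \o (fun w => `|f w - m| ^+ 2)).
  apply: (bounded_integrable P ((2 * M) ^+ 2)) => //.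
    by apply: measurable_funX; exact: measurable_norm.
  move=> w Aw; rewrite ger0_norm ?exprn_ge0 // lerXn2r ?nnegrE ?fmM //.
  exact: le_trans (normr_ge0 _) (fmM w Aw).
have iipf := bounded_integrable_ip s.
have iip : P.-integrable A (EFin \o (fun w => ip (f w) s - ip m s)).
  by apply: integrableBR => //; exact: integrable_cstR.
pose c := a * sinh (a * `|s|) / `|s|.
have h0 := h_ge0 rho.
apply: (@le_trans _ _ (\int[P]_(w in A)
   (cosh (a * `|s|) * (1 + a ^+ 2 * h rho * `|f w - m| ^+ 2) +
    c * (ip (f w) s - ip m s)))).
  apply: le_Rintegral => //.
  - apply: (bounded_integrable P (cosh (a * (`|s| + 2 * M)))) => //.
      apply: measurable_cosh; apply: measurable_funM => //.
      by apply: measurable_norm; apply: measurable_addH => //; exact: measurable_cst.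
    move=> w Aw; rewrite ger0_norm ?cosh_ge0 //.
    apply: cosh_le; first by rewrite mulr_ge0.
    by rewrite ler_wpM2l // (le_trans (ler_normD _ _)) // lerD2l fmM.
  - apply: integrableDR => //; last exact: integrableZR.
    apply: integrableZR => //; apply: integrableDR => //; first exact: integrable_cstR.
    exact: integrableZR.
  - move=> w Aw; apply: (le_trans (cosh_norm_le _ ip_norm _ _ _ a0)).
    rewrite -/c (ipC _ s) -ipBl lerD2r ler_wpM2l ?cosh_ge0 //.
    have := expR_remainder_le rho (a * `|f w - m|) rho0.
    have -> : 0 <= a * `|f w - m| <= 2 * rho.
      rewrite mulr_ge0 //=; apply: (@le_trans _ _ (a * (2 * M))); first by rewrite ler_wpM2l // fmM.
      lra.
    by move=> /(_ isT); rewrite exprMn; lra.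
have ih : P.-integrable A (EFin \o (fun w => a ^+ 2 * h rho * `|f w - m| ^+ 2)).
  exact: integrableZR.
have i1 : P.-integrable A (EFin \o (fun w => 1 + a ^+ 2 * h rho * `|f w - m| ^+ 2)).
  by apply: integrableDR => //; exact: integrable_cstR.
rewrite RintegralD //; [|exact: integrableZR|exact: integrableZR].
rewrite RintegralZl // RintegralD //; last exact: integrable_cstR.
rewrite !RintegralZl // RintegralB //; last exact: integrable_cstR.
rewrite !Rintegral_cst // mE [ip m s * _]mulrC subrr mulr0 addr0 mul1r.
rewrite ler_wpM2l ?cosh_ge0 // lerD2l ler_wpM2l //.
  by rewrite mulr_ge0 ?sqr_ge0.
exact: weak_mean_variance.
Qed.

End WithMean.
End OnSet.
End Mean.

(** * One step of the supermartingale *)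

(** The increment f - (mu - z) around u is written as the centred increment f - m
    around s plus three errors: two of freezing u and z, one of bias. *)
Lemma recentre {V : zmodType} (u s f m mu z z0 : V) :
  u + (f - (mu - z)) = (s + (f - m)) + ((u - s) + (z - z0) + (m - (mu - z0))).
Proof.
rewrite !opprB -[u in LHS](subrK s) -[f in LHS](subrK m) -[z in LHS](subrK z0).
move: (u - s) (f - m) (z - z0) => x y t; rewrite !addrA; do 2 congr (_ + _).
by rewrite [RHS](ACl (3*1*2*5*4))%AC.
Qed.

Section Step.
Context {d} {Omega : measurableType d} {R : realType} (P : probability Omega R).
Context {H : completeNormedModType R} (ip : {dot H for idfun}).
Hypothesis ip_norm : induces_norm ip.
Hypothesis H_sep : separable H.
Context (p lambda rho v r : R) (mu : H).
Hypothesis p_gt1 : 1 < p.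
Hypothesis p_le2 : p <= 2.
Hypothesis lambda_gt0 : 0 < lambda.
Hypothesis rho_gt0 : 0 < rho.
Hypothesis r_ge0 : 0 <= r.
Context (X Z U : Omega -> H).
Hypothesis mX : measurable_fun [set: Omega] (X : Omega -> borel H).
Hypothesis mZ : measurable_fun [set: Omega] (Z : Omega -> borel H).
Hypothesis mU : measurable_fun [set: Omega] (U : Omega -> borel H).
Hypothesis iX : P.-integrable setT (EFin \o (fun w => `|X w|)).
Hypothesis iXp : P.-integrable setT (EFin \o (fun w => `|X w - mu| `^ p)).

Let tau := lambda^-1.
Let a := rho * lambda.
Let f w := clip tau (X w - Z w).
Let K := 2 `^ (p - 1) * kappa p (rho * h rho) * lambda `^ (p - 1) * (v + r `^ p).

Let tau_gt0 : 0 < tau. Proof. by rewrite invr_gt0. Qed.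
Let a_gt0 : 0 < a. Proof. by rewrite mulr_gt0. Qed.

Lemma measurable_residual :
  measurable_fun [set: Omega] ((fun w => X w - Z w) : Omega -> borel H).
Proof. exact: measurable_subH. Qed.

Lemma measurable_clip : measurable_fun [set: Omega] (f : Omega -> borel H).
Proof.
apply: (measurable_continuous (clip tau)); last exact: measurable_residual.
exact: clip_continuous.
Qed.

Lemma clip_le w : `|f w| <= tau.
Proof. by rewrite norm_clip // ge_min lexx orbT. Qed.

Section Localized.
Context (A : set Omega) (s z0 : H) (eps : R).
Hypothesis mA : measurable A.
Hypothesis eps_ge0 : 0 <= eps.
Hypothesis X_mean : forall u, \int[P]_(w in A) ip (X w) u = fine (P A) * ip mu u.
Hypothesis X_moment : \int[P]_(w in A) (`|X w - mu| `^ p) <= fine (P A) * v.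
Hypothesis UA : forall w, A w -> `|U w - s| <= eps.
Hypothesis ZA : forall w, A w -> `|Z w - z0| <= eps.
Hypothesis Zr : forall w, A w -> `|Z w - mu| <= r.

Let iXA : P.-integrable A (EFin \o (fun w => `|X w|)).
Proof. exact: integrableS iX. Qed.
Let iXpA : P.-integrable A (EFin \o (fun w => `|X w - mu| `^ p)).
Proof. exact: integrableS iXp. Qed.

Let iexcess : P.-integrable A (EFin \o (fun w => Num.max (`|X w - Z w| - tau) 0)).
Proof.
apply: (dominated_integrable P (fun w => `|X w| + (`|z0| + eps))) => //.
- apply: measurable_maxr => //; apply: measurable_funB => //.
  by apply: measurable_norm; exact: measurable_residual.
- by apply: integrableDR => //; exact: integrable_cstR.
- move=> w Aw; rewrite ger0_norm ?le_max ?lexx ?orbT // ge_max.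
  have XZ : `|X w - Z w| <= `|X w| + (`|z0| + eps).
    rewrite (le_trans (ler_normB _ _)) // lerD2l -(subrK z0 (Z w)) addrC.
    by rewrite (le_trans (ler_normD _ _)) // lerD2l ZA.
  by rewrite !addr_ge0 // andbT (le_trans _ XZ) // gerBl ltW.
Qed.

(** Testing against b = m - (mu - z0) itself, the mean of X cancels and what is
    left is the displacement of X - Z by the clipping, up to eps. *)
Lemma bias_le (m : H) : 0 < fine (P A) ->
  (forall u, \int[P]_(w in A) ip (f w) u = fine (P A) * ip m u) ->
  fine (P A) * `|m - (mu - z0)| <=
  \int[P]_(w in A) Num.max (`|X w - Z w| - tau) 0 + fine (P A) * eps.
Proof.
move=> PA0 mE; set b := m - (mu - z0).
have RHS0 : 0 <= \int[P]_(w in A) Num.max (`|X w - Z w| - tau) 0 + fine (P A) * eps.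
  rewrite addr_ge0 ?mulr_ge0 // ?(ltW PA0) //; apply: Rintegral_ge0 => w _.
  by rewrite le_max lexx orbT.
have [b0|b0] := eqVneq `|b| 0; first by rewrite b0 mulr0.
have {}b0 : 0 < `|b| by rewrite lt_neqAle eq_sym b0 normr_ge0.
rewrite -(ler_pM2r b0).
have if_ := bounded_integrable_ip P ip ip_norm A f tau mA measurable_clip
  (fun w _ => clip_le w) b.
have iXb := integrable_ip P ip ip_norm A X b mA mX iXA.
have ic : P.-integrable A (EFin \o (fun=> ip z0 b)) by exact: integrable_cstR.
have ifX : P.-integrable A (EFin \o (fun w => ip (f w) b - ip (X w) b)) by exact: integrableBR.
have -> : fine (P A) * `|b| * `|b| =
    \int[P]_(w in A) ((ip (f w) b - ip (X w) b) + ip z0 b).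
  rewrite RintegralD // RintegralB // mE X_mean Rintegral_cst //.
  by rewrite -mulrA -expr2 -ip_norm {1}/b !ipBl; ring.
have iexc : P.-integrable A (EFin \o (fun w => Num.max (`|X w - Z w| - tau) 0 + eps)).
  by apply: integrableDR => //; exact: integrable_cstR.
have -> : (\int[P]_(w in A) Num.max (`|X w - Z w| - tau) 0 + fine (P A) * eps) * `|b| =
   \int[P]_(w in A) (`|b| * (Num.max (`|X w - Z w| - tau) 0 + eps)).
  rewrite RintegralZl // RintegralD //; last exact: integrable_cstR.
  by rewrite Rintegral_cst // mulrC [eps * _]mulrC.
apply: le_Rintegral => //.
- exact: integrableDR.
- exact: integrableZR.
- move=> w Aw.
  have -> : ip (f w) b - ip (X w) b + ip z0 b = ip ((f w - (X w - Z w)) - (Z w - z0)) b.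
    by rewrite !ipBl; ring.
  apply: (le_trans (ler_norm _)); apply: (le_trans (ip_le_norm _ ip_norm _ _)).
  rewrite mulrC ler_wpM2l // (le_trans (ler_normB _ _)) // lerD ?ZA //.
  by rewrite norm_sub_clip.
Qed.

Lemma mean_bias_variance_le :
  \int[P]_(w in A) Num.max (`|X w - Z w| - tau) 0 +
    a * h rho * \int[P]_(w in A) (`|f w| ^+ 2) <= fine (P A) * K.
Proof.
have i2 := bounded_integrable_normX P A f tau mA measurable_clip (fun w _ => clip_le w) 2.
pose k := kappa p (rho * h rho) * lambda `^ (p - 1).
have p0 : 0 <= p := le_trans ler01 (ltW p_gt1).
have k0 : 0 <= k.
  have l0 : 0 <= rho * h rho by rewrite mulr_ge0 ?h_ge0 // ltW.
  by rewrite mulr_ge0 ?powR_ge0 // (le_trans l0) // kappa_ge_id.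
have rp : P.-integrable A (EFin \o (fun=> r `^ p)) by exact: integrable_cstR.
have iXr : P.-integrable A (EFin \o (fun w => `|X w - mu| `^ p + r `^ p)) by exact: integrableDR.
have ih : P.-integrable A (EFin \o (fun w => a * h rho * `|f w| ^+ 2)) by exact: integrableZR.
apply: (@le_trans _ _ (\int[P]_(w in A) ((k * 2 `^ (p - 1)) * (`|X w - mu| `^ p + r `^ p)))).
  rewrite -RintegralZl // -RintegralD //; apply: le_Rintegral => //.
  - exact: integrableDR.
  - exact: integrableZR.
  - move=> w Aw.
    have := clip_bias_variance_le p lambda (rho * h rho) `|X w - Z w| p_gt1 p_le2 lambda_gt0.
    rewrite norm_clip // -/tau -/k.
    have -> : rho * h rho * lambda = a * h rho by rewrite /a; ring.
    move=> /(_ (mulr_ge0 (ltW rho_gt0) (h_ge0 _)) (normr_ge0 _)) /le_trans; apply.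
    rewrite -mulrA ler_wpM2l //.
    apply: (le_trans _ (le_trans (powR_add_le p `|X w - mu| `|Z w - mu| _ _ _) _)) => //.
    + apply: ge0_ler_powR; rewrite ?nnegrE ?addr_ge0 //.
      rewrite -(normrN (Z w - mu)); apply: le_trans (ler_normD _ _).
      by rewrite opprB addrA subrK.
    + exact: ltW.
    + rewrite ler_wpM2l ?powR_ge0 // lerD2l.
      by apply: ge0_ler_powR; rewrite ?nnegrE ?Zr.
rewrite RintegralZl // RintegralD // Rintegral_cst //.
have -> : fine (P A) * K = k * 2 `^ (p - 1) * (fine (P A) * v + r `^ p * fine (P A)).
  by rewrite /K /k; ring.
apply: ler_wpM2l; first by rewrite mulr_ge0 ?powR_ge0.
by rewrite lerD2r.
Qed.

(** The factor 4 * a * eps collects four replacements: U by s before and after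
    the step, Z by z0 in the increment, and Z by z0 in the bias. *)
Lemma localized_step :
  (\int[P]_(w in A) (cosh (a * `|U w + (f w - (mu - Z w))|))%:E <=
  (expR (4 * a * eps + a * K))%:E * \int[P]_(w in A) (cosh (a * `|U w|))%:E)%E.
Proof.
have cosh0 (x : R) : 0 <= cosh x := cosh_ge0 x.
have a0 := ltW a_gt0.
have am0 (x : R) : 0 <= x -> 0 <= a * x by exact: mulr_ge0.
have mf := measurable_clip.
have U_bd w : A w -> `|U w| <= `|s| + eps.
  by move=> Aw; rewrite -(subrK s (U w)) addrC (le_trans (ler_normD _ _)) // lerD2l UA.
have V_bd w : A w -> `|U w + (f w - (mu - Z w))| <= `|s| + eps + (tau + r).
  move=> Aw; rewrite (le_trans (ler_normD _ _)) // lerD ?U_bd //.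
  by rewrite (le_trans (ler_normB _ _)) // lerD ?clip_le // distrC Zr.
have icosh (g : Omega -> H) c : measurable_fun [set: Omega] (g : Omega -> borel H) ->
    (forall w, A w -> `|g w| <= c) ->
    P.-integrable A (EFin \o (fun w => cosh (a * `|g w|))).
  move=> mg gc; apply: (bounded_integrable P (cosh (a * c))) => //.
    by apply: measurable_cosh; apply: measurable_funM => //; exact: measurable_norm.
  move=> w Aw; rewrite ger0_norm //; apply: cosh_le; first by rewrite mulr_ge0.
  by rewrite ler_wpM2l // gc.
have iU := icosh U _ mU U_bd.
have iV : P.-integrable A (EFin \o (fun w => cosh (a * `|U w + (f w - (mu - Z w))|))).
  apply: (icosh _ _ _ V_bd); apply: measurable_addH => //; apply: measurable_subH => //.
  by apply: measurable_subH => //; exact: measurable_cst.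
suff : \int[P]_(w in A) cosh (a * `|U w + (f w - (mu - Z w))|) <=
    expR (4 * a * eps + a * K) * \int[P]_(w in A) cosh (a * `|U w|).
  rewrite -lee_fin EFinM /Rintegral !fineK //; exact: integrable_fin_num.
have [PA0|PA0] := leP (fine (P A)) 0.
  have {}PA0 : fine (P A) = 0 by apply/eqP; rewrite eq_le PA0 fine_ge0.
  apply: (@le_trans _ _ 0); last by rewrite mulr_ge0 ?expR_ge0 // Rintegral_ge0.
  rewrite -(mulr0 (cosh (a * (`|s| + eps + (tau + r))))) -PA0 -Rintegral_cst //.
  apply: le_Rintegral => //; first exact: integrable_cstR.
  move=> w Aw; apply: cosh_le; first by rewrite mulr_ge0.
  by rewrite ler_wpM2l // V_bd.
have [m mE] := weak_mean P ip ip_norm A f tau mA mf (fun w _ => clip_le w) PA0.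
have m_bd := weak_mean_norm P ip ip_norm A f tau mA mf (fun w _ => clip_le w) PA0 m mE.
pose b := `|m - (mu - z0)|.
pose q := \int[P]_(w in A) (`|f w| ^+ 2).
have bq : b + a * h rho * (q / fine (P A)) <= eps + K.
  rewrite -(ler_pM2l PA0) !mulrDr.
  have -> : fine (P A) * (a * h rho * (q / fine (P A))) = a * h rho * q.
    by field; exact: lt0r_neq0.
  by have := bias_le m PA0 mE; have := mean_bias_variance_le; rewrite -/b -/q; lra.
have ism : P.-integrable A (EFin \o (fun w => cosh (a * `|s + (f w - m)|))).
  apply: (icosh _ (`|s| + (tau + tau))).
    apply: measurable_addH; [exact: H_sep|exact: measurable_cst|].
    by apply: measurable_subH; [exact: H_sep|exact: mf|exact: measurable_cst].
  move=> w Aw; rewrite (le_trans (ler_normD _ _)) // lerD2l.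
  by rewrite (le_trans (ler_normB _ _)) // lerD ?clip_le.
apply: (@le_trans _ _ (expR (a * (2 * eps + b)) * \int[P]_(w in A) cosh (a * `|s + (f w - m)|))).
  rewrite -RintegralZl //; apply: le_Rintegral => //; first exact: integrableZR.
 move=> w Aw; apply: cosh_shift; [exact: am0| |exact: am0|].
    by apply: am0; rewrite addr_ge0 ?normr_ge0 // mulr_ge0.
   rewrite -mulrDr ler_wpM2l //.
  rewrite (recentre _ s _ m mu _ z0).
  rewrite (le_trans (ler_normD _ _)) // lerD2l (le_trans (ler_normD _ _)) // lerD2r.
  by rewrite (le_trans (ler_normD _ _)) // mulr_natl mulr2n lerD ?UA ?ZA.
have aM : a * tau <= rho by rewrite /a /tau mulfK // gt_eqF.
have := cosh_mean_le P ip ip_norm H_sep A f tau mA mf (fun w _ => clip_le w) PA0 m mE a rho s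
  a0 rho_gt0 aM.
rewrite -/q => cosh_mean.
have exp_q : fine (P A) + a ^+ 2 * h rho * q <=
    fine (P A) * expR (a * (a * h rho * (q / fine (P A)))).
  have -> : fine (P A) + a ^+ 2 * h rho * q =
      fine (P A) * (1 + a * (a * h rho * (q / fine (P A)))).
    by field; exact: lt0r_neq0.
  by rewrite ler_pM2l // expR_ge1Dx.
apply: (@le_trans _ _ (expR (a * (3 * eps + K)) * (fine (P A) * cosh (a * `|s|)))).
  apply: (@le_trans _ _ (expR (a * (2 * eps + b)) *
     (cosh (a * `|s|) * (fine (P A) * expR (a * (a * h rho * (q / fine (P A)))))))).
    rewrite ler_wpM2l ?expR_ge0 // (le_trans cosh_mean) // ler_wpM2l //.
  have -> : forall x y c c' : R, expR x * (c * (c' * expR y)) = expR (x + y) * (c' * c).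
    by move=> x y c c'; rewrite expRD; ring.
  rewrite ler_wpM2r ?mulr_ge0 ?(ltW PA0) // ler_expR -mulrDr ler_wpM2l //; lra.
have -> : expR (4 * a * eps + a * K) = expR (a * (3 * eps + K)) * expR (a * eps).
  by rewrite -expRD; congr expR; ring.
rewrite -mulrA ler_wpM2l ?expR_ge0 // -RintegralZl // mulrC -Rintegral_cst //.
apply: le_Rintegral => //; [exact: integrable_cstR|exact: integrableZR|].
move=> w Aw; apply: cosh_shift; [exact: am0|exact: am0|exact: am0|].
rewrite -mulrDr ler_wpM2l //.
by rewrite -(subrK (U w) s) addrC (le_trans (ler_normD _ _)) // lerD2l distrC UA.
Qed.

End Localized.

Section Conditional.
Context (G : set (set Omega)).
Hypothesis G_sigma : sigma_algebra [set: Omega] G.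
Hypothesis G_meas : G `<=` measurable.
Hypothesis U_G : measurable_wrt G (U : Omega -> borel H).
Hypothesis Z_G : measurable_wrt G (Z : Omega -> borel H).
Hypothesis X_mean : forall A, G A ->
  forall u, \int[P]_(w in A) ip (X w) u = fine (P A) * ip mu u.
Hypothesis X_moment : forall A, G A ->
  \int[P]_(w in A) (`|X w - mu| `^ p) <= fine (P A) * v.

Lemma measurable_step :
  measurable_fun [set: Omega] ((fun w => U w + (f w - (mu - Z w))) : Omega -> borel H).
Proof.
apply: measurable_addH => //; apply: measurable_subH; [exact: H_sep|exact: measurable_clip|].
by apply: measurable_subH => //; exact: measurable_cst.
Qed.

Lemma measurable_cosh_norm (g : Omega -> H) :
  measurable_fun [set: Omega] (g : Omega -> borel H) ->
  measurable_fun [set: Omega] (fun w => (cosh (a * `|g w|))%:E).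
Proof.
move=> mg; apply/measurable_EFinP; apply: measurable_cosh.
by apply: measurable_funM => //; exact: measurable_norm.
Qed.

(** The pieces of B are indexed by pairs of points of a dense sequence, one near
    U and one near Z, and made disjoint inside the sigma-algebra G. *)
Lemma approx_step (B : set Omega) (eps : R) : G B -> 0 < eps ->
  (forall w, B w -> `|Z w - mu| <= r) ->
  (\int[P]_(w in B) (cosh (a * `|U w + (f w - (mu - Z w))|))%:E <=
  (expR (4 * a * eps + a * K))%:E * \int[P]_(w in B) (cosh (a * `|U w|))%:E)%E.
Proof.
move=> GB eps0 Br.
have cosh0 (x : R) : (0 <= (cosh x)%:E)%E by rewrite lee_fin cosh_ge0.
have [e e_dense] := separable_dense_seq H_sep.
pose C (n : nat) : set Omega := if (choice.unpickle n : option (nat * nat)) is Some q then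
  B `&` (U @^-1` ball (e q.1) eps `&` Z @^-1` ball (e q.2) eps) else set0.
have CG n : measurable (C n : set (g_sigma_algebraType G)).
  rewrite /C; case: (choice.unpickle _) => [q|]; last exact: measurable0.
  apply: measurableI; first exact: sub_sigma_algebra.
  by apply: measurableI;
    apply: (@borel_open_preimage _ _ _ (g_sigma_algebraType G)) => //; exact: ball_open.
pose D := seqDU C.
have DG n : G (D n).
  rewrite -(sigma_algebra_id G_sigma); apply: (@measurableD _ (g_sigma_algebraType G)) => //.
  by apply: (@bigsetU_measurable _ (g_sigma_algebraType G)) => i _.
have BD : B = \bigcup_n D n.
  rewrite -seqDU_bigcup_eq; apply/seteqP; split => w.
    move=> Bw; have [i Ui] := e_dense (U w) _ eps0; have [j Zj] := e_dense (Z w) _ eps0.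
    exists (choice.pickle (i, j)) => //; rewrite /C choice.pickleK; split => //.
    by split; rewrite /preimage -ball_normE /= distrC.
  by move=> [n _]; rewrite /C; case: (choice.unpickle _) => // q [].
have mD n : measurable (D n) by exact: G_meas.
have DB n : D n `<=` B by move=> w Dw; rewrite BD; exists n.
have loc n : (\int[P]_(w in D n) (cosh (a * `|U w + (f w - (mu - Z w))|))%:E <=
  (expR (4 * a * eps + a * K))%:E * \int[P]_(w in D n) (cosh (a * `|U w|))%:E)%E.
  have [q Dq] : exists q, forall w, D n w -> `|U w - e q.1| < eps /\ `|Z w - e q.2| < eps.
    have := @subset_seqDU _ C n; rewrite -/D /C; case: (choice.unpickle _) => [q|] sub; last first.
      by exists (0%N, 0%N) => w /sub.
    exists q => w /sub [_ [/=]]; rewrite -!ball_normE /= => H1 H2.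
    by split; rewrite distrC.
  apply: (localized_step (D n) (e q.1) (e q.2)) => //.
  - exact: ltW.
  - exact: X_mean.
  - exact: X_moment.
  - by move=> w /Dq[/ltW].
  - by move=> w /Dq[_ /ltW].
  - by move=> w /DB; exact: Br.
rewrite BD !ge0_integral_bigcup //; try exact: trivIset_seqDU; try by move=> *; exact: cosh0.
- rewrite -nneseriesZl; last by move=> *; apply: integral_ge0 => w _; exact: cosh0.
  by apply: lee_nneseries => [*|n _]; [apply: integral_ge0 => w _; exact: cosh0|exact: loc].
- by apply: measurable_funTS; exact: measurable_cosh_norm.
- by apply: measurable_funTS; apply: measurable_cosh_norm; exact: measurable_step.
Qed.

Lemma conditional_step (B : set Omega) : G B ->
  (forall w, B w -> `|Z w - mu| <= r) ->
  (\int[P]_(w in B) (cosh (a * `|U w + (f w - (mu - Z w))|))%:E <=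
  (expR (a * K))%:E * \int[P]_(w in B) (cosh (a * `|U w|))%:E)%E.
Proof.
move=> GB Br.
have cosh0 (x : R) : (0 <= (cosh x)%:E)%E by rewrite lee_fin cosh_ge0.
have step eps := approx_step B eps GB ^~ Br.
set y := (\int[P]_(w in B) (cosh (a * `|U w|))%:E)%E in step *.
set x := (\int[P]_(w in B) _)%E in step *.
have x0 : (0 <= x)%E by apply: integral_ge0 => w _; exact: cosh0.
have : (0 <= y)%E by apply: integral_ge0 => w _; exact: cosh0.
case: y step => [y| |] // step y0; last first.
  by rewrite gt0_muley ?leey // lte_fin expR_gt0.
have : x \is a fin_num.
  by rewrite ge0_fin_numE // (le_lt_trans (step 1 ltr01)) // -EFinM ltry.
case: x x0 step => [x| |] // x0 step _.
rewrite -EFinM lee_fin; apply/ler_addgt0Pr => e e0.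
rewrite lee_fin in x0.
have D0 : 0 < x + 1 by rewrite ltr_wpDl.
have t0 : 0 < e / (x + 1) by rewrite divr_gt0.
have := step _ (divr_gt0 t0 (mulr_gt0 (ltr0n _ 4) a_gt0)).
rewrite -EFinM lee_fin.
have -> : 4 * a * (e / (x + 1) / (4 * a)) = e / (x + 1) by field; rewrite !gt_eqF.
rewrite expRD -mulrA => xle.
have : (1 - e / (x + 1)) * x <= expR (a * K) * y.
  rewrite -(ler_pM2l (expR_gt0 (e / (x + 1)))); apply: le_trans xle.
  rewrite mulrA -[leRHS]mul1r ler_wpM2r // -[leRHS](expR0 R) -(subrr (e / (x + 1))) expRD.
  by rewrite ler_pM2l ?expR_gt0 // expR_ge1Dx.
have : e / (x + 1) * x <= e by rewrite mulrAC ler_pdivrMr // ler_pM2l // lerDl.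
lra.
Qed.

End Conditional.
End Step.

(** * A maximal inequality *)
Section Filtered.
Context {d} {Omega : measurableType d} (F : nat -> set (set Omega)).
Hypothesis F_filt : filtration F.

Lemma measurable_wrt_mono d' (T : measurableType d') (f : Omega -> T) i j :
  (i <= j)%N -> measurable_wrt (F i) f -> measurable_wrt (F j) f.
Proof.
move=> ij mf _ Y mY; have [F_sigma _ F_mono] := F_filt.
have := mf measurableT Y mY.
by rewrite /measurable /= !sigma_algebra_id //; exact: F_mono.
Qed.

Lemma measurable_wrt_ambient d' (T : measurableType d') (f : Omega -> T) i :
  measurable_wrt (F i) f -> measurable_fun [set: Omega] f.
Proof.
move=> mf _ Y mY; have [F_sigma F_meas _] := F_filt.
apply: (F_meas i); have := mf measurableT Y mY.
by rewrite {1}/measurable /= sigma_algebra_id.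
Qed.

Lemma measurable_wrt_set i (A : set Omega) :
  F i A = measurable (A : set (g_sigma_algebraType (F i))).
Proof.
by have [F_sigma _ _] := F_filt; rewrite [RHS]/measurable /= sigma_algebra_id.
Qed.

(** Ville's inequality.  The event D j that the level c is first reached at time
    j belongs to F j, and so does the event that it is not reached up to time j.
    Hence the integral of M n over the paths that avoid c before time n, plus
    the integrals of M i over D i for i < n, never exceeds the initial one. *)
Lemma ville {R : realType} (P : probability Omega R) (M : nat -> Omega -> R)
    (B : set Omega) (c : R) :
  (forall i w, 0 <= M i w) -> (forall i, measurable_wrt (F i) (M i)) ->
  F 0%N B ->
  (forall i A, F i A -> A `<=` B ->
    (\int[P]_(w in A) (M i.+1 w)%:E <= \int[P]_(w in A) (M i w)%:E)%E) ->
  0 <= c ->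
  (c%:E * P (\bigcup_i (B `&` [set w | (c <= M i w)%R])) <= \int[P]_(w in B) (M 0%N w)%:E)%E.
Proof.
move=> M0 M_F B_F M_step c0; have [F_sigma F_meas F_mono] := F_filt.
pose C i := B `&` [set w | c <= M i w].
have C_F i : F i (C i).
  rewrite measurable_wrt_set; apply: measurableI.
    by rewrite -measurable_wrt_set; exact: F_mono B_F.
  have := M_F i measurableT `[c, +oo[%classic (measurable_itv _).
  rewrite setTI; congr (measurable _); apply/seteqP; split => w /=;
    by rewrite in_itv /= andbT.
pose D := seqDU C.
pose rest n := B `\` \big[setU/set0]_(i < n) C i.
have past_F n m : (forall i, (i < n)%N -> (i <= m)%N) -> F m (\big[setU/set0]_(i < n) C i).
  move=> nm; rewrite measurable_wrt_set; apply: bigsetU_measurable => i _.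
  by rewrite -measurable_wrt_set; apply: F_mono (C_F i); exact: nm.
have rest_F n m : (forall i, (i < n)%N -> (i <= m)%N) -> F m (rest n).
  move=> nm; have := past_F n m nm; rewrite !measurable_wrt_set => past_m.
  apply: measurableD => //; rewrite -measurable_wrt_set; exact: F_mono B_F.
have D_F n : F n (D n).
  have := past_F n n (fun i => @ltnW i n); have := C_F n.
  by rewrite !measurable_wrt_set => Cn past_n; exact: measurableD.
have mM i : measurable_fun setT (fun w => (M i w)%:E).
  by apply/measurable_EFinP; exact: measurable_wrt_ambient.
have mD n : measurable (D n) by exact: F_meas (D_F n).
have mrest n : measurable (rest n) by exact: F_meas (rest_F n n (fun i => @ltnW i n)).
have rest_split n : rest n = D n `|` rest n.+1.
  rewrite /rest /D /seqDU big_ord_recr /=; apply/seteqP; split => w /=.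
    move=> [Bw past_w]; have [Cw|Cw] := pselect (C n w); first by left.
    by right; split => // -[].
  move=> [[Cw past_w]|[Bw past_w]]; first by split => //; case: Cw.
  by split => // past'_w; apply: past_w; left.
have disj n : [disjoint D n & rest n.+1].
  rewrite disj_set2E; apply/eqP/seteqP; split => w //= [[Cw _] [_ /=]].
  by rewrite big_ord_recr /=; apply; right.
have accum n : (\sum_(i < n) \int[P]_(w in D i) (M i w)%:E +
    \int[P]_(w in rest n) (M n w)%:E <= \int[P]_(w in B) (M 0%N w)%:E)%E.
  elim: n => [|n IHn]; first by rewrite big_ord0 add0e /rest big_ord0 setD0.
  apply: le_trans IHn; rewrite big_ord_recr /= -addeA leeD2l //.
  rewrite [in leRHS]rest_split ge0_integral_setU //.
  - rewrite leeD2l //; apply: M_step; last by move=> w [].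
    by apply: rest_F => i.
  - exact: measurable_funTS.
  - by move=> w _; rewrite lee_fin.
have D_le i : (c%:E * P (D i) <= \int[P]_(w in D i) (M i w)%:E)%E.
  rewrite -integral_cst //; apply: ge0_le_integral => //.
  - exact: measurable_funTS.
  - by move=> w Dw; have [_ /=] := @subset_seqDU _ C i w Dw; rewrite lee_fin.
have -> : \bigcup_i (B `&` [set w | c <= M i w]) = \bigcup_i D i by exact: seqDU_bigcup_eq.
rewrite measure_bigcup //; last exact: trivIset_seqDU.
rewrite -nneseriesZl; last by move=> i _.
apply: lime_le; first by apply: is_cvg_nneseries => i _ _; rewrite mule_ge0 ?lee_fin.
near=> n; apply: le_trans (accum n); rewrite big_mkord.
apply: (@le_trans _ _ (\sum_(i < n) \int[P]_(w in D i) (M i w)%:E)%E).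
  rewrite big_mkcond; apply: lee_sum => i _; rewrite in_setT; exact: D_le.
by rewrite leeDl // integral_ge0 // => w _; rewrite lee_fin.
Unshelve. all: by end_near.
Qed.

End Filtered.

(** * Conditional moments as integrals over events *)
Section Moments.
Context {d} {Omega : measurableType d} {R : realType} (P : probability Omega R).
Context {H : completeNormedModType R} (ip : {dot H for idfun}).
Hypothesis ip_norm : induces_norm ip.
Hypothesis H_sep : separable H.
Context (F : nat -> set (set Omega)) (F_filt : filtration F).
Context (X : Omega -> H) (mu : H) (i : nat).
Hypothesis mX : measurable_fun [set: Omega] (X : Omega -> borel H).

Lemma condexp_integrable (Y : Omega -> H) :
  is_bochner_condexp P (F i) X Y -> P.-integrable setT (EFin \o (fun w => `|X w|)).
Proof.
by move=> [[z Xz] _ _ _]; exact: bochner_integrable_norm H_sep _ _ _ _ mX Xz.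
Qed.

Lemma condexp_mean (Y : Omega -> H) :
  is_bochner_condexp P (F i) X Y -> {ae P, forall w, Y w = mu} ->
  forall A, F i A ->
  forall u, \int[P]_(w in A) ip (X w) u = fine (P A) * ip mu u.
Proof.
move=> [_ _ mY XY] Ymu A FA u; have [_ F_meas _] := F_filt.
have mA : measurable A by exact: F_meas FA.
have {}mY : measurable_fun [set: Omega] (Y : Omega -> borel H).
  exact: measurable_wrt_ambient F_filt _ _ _ _ mY.
have [z Xz Yz] := XY A FA.
rewrite (bochner_integral_ip P ip ip_norm H_sep A X z u mA mX Xz).
rewrite -(bochner_integral_ip P ip ip_norm H_sep A Y z u mA mY Yz).
rewrite mulrC -Rintegral_cst //; congr fine; apply: ae_eq_integral => //.
- apply/measurable_EFinP; apply: measurable_funTS; exact: measurable_ip.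
- by apply: filterS Ymu => w Ew _; rewrite Ew.
Qed.

Lemma condexp_moment (p v : R) (Y : Omega -> \bar R) : 0 <= v ->
  is_nonneg_condexp P (F i) (fun w => (`|X w - mu| `^ p)%:E) Y ->
  {ae P, forall w, (Y w <= v%:E)%E} ->
  forall A, F i A ->
  (\int[P]_(w in A) (`|X w - mu| `^ p)%:E <= (fine (P A) * v)%:E)%E.
Proof.
move=> v0 [Y0 mY XY] Yv A FA; have [_ F_meas _] := F_filt.
have mA : measurable A by exact: F_meas FA.
have {}mY : measurable_fun [set: Omega] Y.
  exact: measurable_wrt_ambient F_filt _ _ _ _ mY.
rewrite -XY // EFinM fineK ?fin_num_measure // muleC -integral_cst //.
apply: ae_ge0_le_integral => //.
- exact: measurable_funTS.
- by apply: filterS Yv => w.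
Qed.

Lemma moment_integrable (p v : R) :
  (\int[P]_w (`|X w - mu| `^ p)%:E <= v%:E)%E ->
  P.-integrable setT (EFin \o (fun w => `|X w - mu| `^ p)).
Proof.
move=> Xv; apply/integrableP; split.
  apply/measurable_EFinP.
  have mn : measurable_fun setT (fun w => `|X w - mu|).
    by apply: measurable_norm; apply: measurable_subH => //; exact: measurable_cst.
  by have := @measurableT_comp _ _ _ Omega _ _ (fun x : R => x `^ p) setT _ (measurable_powR p) mn.
under eq_integral do rewrite /= ger0_norm ?powR_ge0 //.
by rewrite (le_lt_trans Xv) // ltry.
Qed.

End Moments.

(** * The confidence bound *)
Lemma mu_hat_error {R : realType} {H : completeNormedModType R} {Omega : Type}
    (X : nat -> Omega -> H) (Z : Omega -> H) (mu : H) (lambda : R) k j w :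
  (j.+1)%:R *: (mu_hat X Z lambda k (k + j.+1) w - mu) =
  \sum_(k.+1 <= i < (k + j.+1).+1) (clip lambda^-1 (X i w - Z w) - (mu - Z w)).
Proof.
rewrite /mu_hat addKn sumrB sumr_const_nat subSS addKn.
rewrite addrAC scalerDr scalerA mulfV ?pnatr_eq0 // scale1r [LHS]addrC.
by rewrite -mulNrn opprB scaler_nat.
Qed.

Theorem theorem5p1 (R : realType)
  (H : completeNormedModType R) (ip : {dot H for idfun})
  (ip_norm : induces_norm ip) (H_sep : separable H)
  (p : R) (p_gt1 : 1 < p) (p_le2 : p <= 2)
  (d : measure_display) (Omega : measurableType d) (P : probability Omega R)
  (F : nat -> set (set Omega)) (F_filt : filtration F)
  (X : nat -> Omega -> H)
  (X_adapted : forall i, (1 <= i)%N ->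
    measurable_wrt (F i) (X i : Omega -> borel H))
  (mu : H) (v : R) (v_ge0 : 0 <= v)
  (X_mean : forall i, (1 <= i)%N ->
    exists2 Y : Omega -> H, is_bochner_condexp P (F i.-1) (X i) Y &
      {ae P, forall w, Y w = mu})
  (X_moment : forall i, (1 <= i)%N ->
    exists2 Y : Omega -> \bar R,
      is_nonneg_condexp P (F i.-1)
        (fun w => (`|X i w - mu| `^ p)%:E) Y &
      {ae P, forall w, (Y w <= v%:E)%E})
  (k : nat) (k_ge1 : (1 <= k)%N)
  (lambda rho : R) (lambda_gt0 : 0 < lambda) (rho_gt0 : 0 < rho)
  (delta1 delta2 : R) (delta1_01 : 0 < delta1 < 1) (delta2_01 : 0 < delta2 < 1)
  (delta_lt1 : delta1 + delta2 < 1)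
  (Z : Omega -> H) (Z_meas : measurable_wrt (F k) (Z : Omega -> borel H))
  (r : R -> nat -> R)
  (Z_pilot : (P [set w | (r delta2 k <= `|Z w - mu|)%R] <= delta2%:E)%E) :
  exists E : set Omega,
    [/\ measurable E,
        ((1 - delta1 - delta2)%:E <= P E)%E &
        forall w, E w -> forall n, (k < n)%N ->
          `|mu_hat X Z lambda k n w - mu| <=
            2 `^ (p - 1) * kappa p (rho * h rho) * lambda `^ (p - 1)
              * (v + r delta2 k `^ p)
            + ln (2 / delta1) / (rho * lambda * (n - k)%:R)].
Proof.
have [F_sigma F_meas F_mono] := F_filt.
pose r0 := r delta2 k.
(* Otherwise the pilot hypothesis would bound the whole space by delta2 < 1. *)
have r_gt0 : 0 < r0.
  rewrite ltNge; apply/negP => r_le0.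
  have : (P setT <= delta2%:E)%E.
    suff <- : [set w | r delta2 k <= `|Z w - mu|] = setT by [].
    by apply/seteqP; split => w //= _; exact: le_trans r_le0 _.
  by rewrite probability_setT lee_fin; case/andP: delta2_01 => _; rewrite ltNge => /negP.
pose a := rho * lambda.
have a_gt0 : 0 < a by rewrite mulr_gt0.
pose K := 2 `^ (p - 1) * kappa p (rho * h rho) * lambda `^ (p - 1) * (v + r0 `^ p).
pose S j w := \sum_(k.+1 <= i < (k + j).+1) (clip lambda^-1 (X i w - Z w) - (mu - Z w)).
have S0 w : S 0%N w = 0 by rewrite /S addn0 big_geq.
have SS j w : S j.+1 w = S j w + (clip lambda^-1 (X (k + j).+1 w - Z w) - (mu - Z w)).
  by rewrite /S addnS big_nat_recr //= ltnS leq_addr.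
pose Fk j := F (k + j)%N.
have Fk_filt : filtration Fk.
  by split=> [j|j|i j ij]; [exact: F_sigma|exact: F_meas|apply: F_mono; rewrite leq_add2l].
have Z_F j : measurable_wrt (Fk j) (Z : Omega -> borel H).
  by apply: (measurable_wrt_mono F F_filt _ (borel H) Z k (k + j)) => //; exact: leq_addr.
have X_F j : measurable_wrt (Fk j.+1) (X (k + j).+1 : Omega -> borel H).
  by rewrite /Fk addnS; exact: X_adapted.
have S_F j : measurable_wrt (Fk j) (S j : Omega -> borel H).
  elim: j => [|j IHj].
    have -> : S 0%N = fun=> 0 by apply/funext => w; exact: S0.
    exact: measurable_cst.
  have -> : S j.+1 = fun w => S j w + (clip lambda^-1 (X (k + j).+1 w - Z w) - (mu - Z w)).
    by apply/funext => w; exact: SS.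
  apply: (@measurable_addH _ _ _ (g_sigma_algebraType (Fk j.+1)) H_sep).
    by apply: (measurable_wrt_mono Fk Fk_filt _ (borel H) _ j).
  apply: (@measurable_subH _ _ _ (g_sigma_algebraType (Fk j.+1)) H_sep).
    apply: (@measurable_continuous _ _ _ (g_sigma_algebraType (Fk j.+1)) (clip lambda^-1)).
      by apply: clip_continuous; rewrite invr_gt0.
    by apply: (@measurable_subH _ _ _ (g_sigma_algebraType (Fk j.+1)) H_sep);
      [exact: X_F|exact: Z_F].
  apply: (@measurable_subH _ _ _ (g_sigma_algebraType (Fk j.+1)) H_sep); last exact: Z_F.
  exact: measurable_cst.
pose B := [set w | `|Z w - mu| < r0].
have B_F : Fk 0%N B.
  rewrite (measurable_wrt_set _ Fk_filt).
  have -> : B = Z @^-1` ball mu r0.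
    by apply/seteqP; split => w; rewrite /preimage -ball_normE /B /= distrC.
  apply: (@borel_open_preimage _ _ _ (g_sigma_algebraType (Fk 0%N))); last exact: ball_open.
  exact: Z_F.
(* Time is counted from k, so that M 0 = 1. *)
pose M j w := expR (- (a * K) * j%:R) * cosh (a * `|S j w|).
have M_ge0 j w : 0 <= M j w.
  by rewrite mulr_ge0 ?expR_ge0 ?cosh_ge0.
have M_F j : measurable_wrt (Fk j) (M j).
  apply: (@measurable_funM _ (g_sigma_algebraType (Fk j))); first exact: measurable_cst.
  apply: (@measurable_cosh _ _ (g_sigma_algebraType (Fk j))).
  apply: (@measurable_funM _ (g_sigma_algebraType (Fk j))); first exact: measurable_cst.
  by apply: (@measurable_norm _ _ _ (g_sigma_algebraType (Fk j))); exact: S_F.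
have M_step j A : Fk j A -> A `<=` B ->
    (\int[P]_(w in A) (M j.+1 w)%:E <= \int[P]_(w in A) (M j w)%:E)%E.
  move=> FA AB.
  have mX : measurable_fun [set: Omega] (X (k + j).+1 : Omega -> borel H).
    exact: (measurable_wrt_ambient Fk Fk_filt _ _ _ _ (X_F j)).
  have mS i : measurable_fun [set: Omega] (S i : Omega -> borel H).
    exact: (measurable_wrt_ambient Fk Fk_filt _ _ _ _ (S_F i)).
  have mZ : measurable_fun [set: Omega] (Z : Omega -> borel H).
    exact: (measurable_wrt_ambient Fk Fk_filt _ _ _ _ (Z_F 0%N)).
  have mcosh i : measurable_fun [set: Omega] (fun w => (cosh (a * `|S i w|))%:E).
    exact: measurable_cosh_norm.
  have [Y XY Ymu] := X_mean _ (ltn0Sn (k + j)).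
  have [Y' XY' Yv] := X_moment _ (ltn0Sn (k + j)).
  have moment := condexp_moment P F F_filt _ mu _ _ _ _ v_ge0 XY' Yv.
  have mA : measurable A by exact: (F_meas _ _ FA).
  have cosh0 (x : R) : (0 <= (cosh x)%:E)%E by rewrite lee_fin cosh_ge0.
  have iXp : P.-integrable setT (EFin \o (fun w => `|X (k + j).+1 w - mu| `^ p)).
    apply: (moment_integrable P H_sep _ _ mX _ v).
    have F_T : F (k + j)%N setT by rewrite (measurable_wrt_set F F_filt); exact: measurableT.
    by have := moment _ F_T; rewrite probability_setT mul1r.
  rewrite /M; under eq_integral do rewrite EFinM.
  under [leRHS]eq_integral do rewrite EFinM.
  rewrite !ge0_integralZl_EFin ?expR_ge0 //; try exact: measurable_funTS.
  have momentR A' : Fk j A' ->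
      \int[P]_(w in A') (`|X (k + j).+1 w - mu| `^ p) <= fine (P A') * v.
    move=> FA'; have mA' : measurable A' by exact: (F_meas _ _ FA').
    rewrite -lee_fin /Rintegral fineK; first exact: moment FA'.
    by apply: integrable_fin_num => //; exact: integrableS iXp.
  have step := conditional_step P ip ip_norm H_sep p lambda rho v r0 mu p_gt1 p_le2 lambda_gt0
    rho_gt0 (ltW r_gt0) (X (k + j).+1) Z (S j) mX mZ (mS j)
    (condexp_integrable P H_sep F _ _ mX Y XY) iXp (Fk j) (F_sigma _) (F_meas _) (S_F j) (Z_F j)
    (condexp_mean P ip ip_norm H_sep F F_filt _ _ _ mX Y XY Ymu) momentR A FA
    (fun w Aw => ltW (AB w Aw)).
  under eq_integral do rewrite SS.
  apply: (le_trans (lee_wpmul2l _ step)); first by rewrite lee_fin expR_ge0.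
  rewrite muleA -EFinM -expRD le_eqVlt; apply/orP; left; apply/eqP; congr (_ * _)%E.
  by congr (expR _)%:E; rewrite -/a -/K -natr1; ring.
have [delta1_gt0 delta1_lt1] := andP delta1_01.
have c_ge0 : 0 <= delta1^-1 by rewrite invr_ge0 ltW.
have := ville Fk Fk_filt P M B _ M_ge0 M_F B_F M_step c_ge0.
set bad := \bigcup_i _ => bad_le.
have mB : measurable B by exact: F_meas B_F.
have mbad : measurable bad.
  apply: bigcupT_measurable => i; apply: measurableI => //.
  have mM : measurable_fun setT (M i) by exact: (measurable_wrt_ambient Fk Fk_filt _ _ _ _ (M_F i)).
  have := mM measurableT `[delta1^-1, +oo[%classic (measurable_itv _).
  rewrite setTI; congr (measurable _); apply/seteqP; split => w /=;
    by rewrite in_itv /= andbT.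
have P_bad : (P bad <= delta1%:E)%E.
  rewrite -(@lee_pmul2l _ delta1^-1%:E) ?lte_fin ?invr_gt0 //.
  apply: (le_trans bad_le); rewrite -EFinM mulVf ?gt_eqF //.
  rewrite (eq_integral (cst 1%E)); last first.
    move=> w _; rewrite /M mulr0 expR0 mul1r S0 normr0 mulr0 /cosh oppr0 expR0 /=.
    by congr EFin; field.
  by rewrite integral_cst // mul1e probability_le1.
exists (B `\` bad); split.
- exact: measurableD.
- have cover : (1 <= P (B `\` bad) + (P bad + P (~` B)))%E.
    rewrite -(probability_setT P) addeA.
    have -> : setT = ((B `\` bad) `|` bad) `|` ~` B.
      apply/seteqP; split => w //= _.
      have [Bw|Bw] := pselect (B w); last by right.
      by left; have [bw|bw] := pselect (bad w); [right|left].
    have mD : measurable (B `\` bad) by exact: measurableD.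
    apply: (le_trans (measureU2 P _ _)); [exact: measurableU|exact: measurableC|].
    by rewrite leeD2r // measureU2.
  have {}Z_pilot : (P (~` B) <= delta2%:E)%E.
    suff -> : ~` B = [set w | r delta2 k <= `|Z w - mu|] by [].
    by apply/seteqP; split => w; rewrite /B /= leNgt => /negP.
  have : (1 <= P (B `\` bad) + (delta1%:E + delta2%:E))%E.
    by apply: (le_trans cover); rewrite leeD2l // leeD.
  rewrite -leeBlDr //= -EFinD; congr (_ <= _)%E.
  by rewrite opprD addrA.
- move=> w [Bw good_w] n kn.
  have -> : n = (k + (n - k.+1).+1)%N by rewrite -subSn // subSS subnKC // ltnW.
  move: (n - k.+1)%N => j; rewrite addKn.
  have Mj : M j.+1 w < delta1^-1.
    by rewrite ltNge; apply/negP => Mj; apply: good_w; exists j.+1.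
  have j_gt0 : 0 < j.+1%:R :> R by rewrite ltr0n.
  have aj_gt0 : 0 < a * j.+1%:R by rewrite mulr_gt0.
  have err : j.+1%:R * `|mu_hat X Z lambda k (k + j.+1) w - mu| = `|S j.+1 w|.
    by rewrite -(ger0_norm (ltW j_gt0)) -normrZ mu_hat_error.
  have dist : a * `|S j.+1 w| <= ln (2 / delta1) + a * K * j.+1%:R.
    rewrite -ler_expR expRD lnK ?posrE ?divr_gt0 //.
    apply: (@le_trans _ _ (2 * cosh (a * `|S j.+1 w|))).
      by rewrite /cosh; have := expR_gt0 (- (a * `|S j.+1 w|)); lra.
    rewrite -[leRHS]mulrA ler_pM2l //.
    have -> : cosh (a * `|S j.+1 w|) = M j.+1 w * expR (a * K * j.+1%:R).
      by rewrite /M [RHS]mulrAC -expRD mulNr addNr expR0 mul1r.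
    by rewrite ler_pM2r ?expR_gt0 // ltW.
  rewrite -(ler_pM2l aj_gt0) -[leLHS]mulrA err -/r0 -/K mulrDr.
  apply: (le_trans dist); rewrite addrC lerD //.
    by rewrite mulrAC.
  by rewrite -/a mulrCA mulfV ?mulr1 // gt_eqF.
Qed.
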